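(* Let $E\subset\mathbb{R}^3$ be a convex, cuboidal hexahedron and let $$V_0(E)=\mathbb{P}_0^3\oplus\mathbf{x}\,\mathbb{P}_0\oplus\mathrm{span}\{\sigma^{1,3},\sigma^{3,5}\},$$ where $\mathbb{P}_0$ denotes the constants and $\sigma^{1,3},\sigma^{3,5}$ are the lowest order supplements defined in the context. Every $\mathbf{v}\in V_0(E)$ has constant normal flux $\mathbf{v}\cdot\nu_i$ on each face $f_i$, and the six normal fluxes are independent degrees of freedom: the linear map $V_0(E)\to\mathbb{R}^6$, $\mathbf{v}\mapsto(\mathbf{v}\cdot\nu_0|_{f_0},\dots,\mathbf{v}\cdot\nu_5|_{f_5})$, is a bijection. Moreover, set $\alpha=(\mathbf{x}-\mathbf{x}_{024})\cdot\nu_1|_{f_1}$, $\beta=(\mathbf{x}-\mathbf{x}_{024})\cdot\nu_3|_{f_3}$, $\gamma=(\mathbf{x}-\mathbf{x}_{024})\cdot\nu_5|_{f_5}$ (positive constants) and $D=|f_1|\alpha+|f_3|\beta+|f_5|\gamma$. The functions $$\phi_1=\frac{|f_1|}{D}\Big(\mathbf{x}-\mathbf{x}_{024}+(|f_3|\beta+|f_5|\gamma)\sigma^{1,3}+|f_5|\gamma\,\sigma^{3,5}\Big),$$ $$\phi_3=\frac{|f_3|}{D}\Big(\mathbf{x}-\mathbf{x}_{024}-|f_1|\alpha\,\sigma^{1,3}+|f_5|\gamma\,\sigma^{3,5}\Big),$$ $$\phi_5=\frac{|f_5|}{D}\Big(\mathbf{x}-\mathbf{x}_{024}-|f_1|\alpha\,\sigma^{1,3}-(|f_1|\alpha+|f_3|\beta)\sigma^{3,5}\Big),$$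 and, for $(i,\mathbf{n}_i)\in\{(0,\nu_2\times\nu_4),\ (2,\nu_0\times\nu_4),\ (4,\nu_0\times\nu_2)\}$, $$\phi_i=\frac{\mathbf{n}_i-(\mathbf{n}_i\cdot\nu_1)\phi_1-(\mathbf{n}_i\cdot\nu_3)\phi_3-(\mathbf{n}_i\cdot\nu_5)\phi_5}{\mathbf{n}_i\cdot\nu_i},$$ satisfy $\phi_i\cdot\nu_j|_{f_j}=\delta_{ij}$ for all $i,j\in\{0,\dots,5\}$.
   Context: A convex, cuboidal hexahedron $E$ is a (nondegenerate) convex polyhedron in $\mathbb{R}^3$, combinatorially a cube, with six flat quadrilateral faces $f_0,\dots,f_5$, where $f_{2k}$ and $f_{2k+1}$ ($k=0,1,2$) are opposite, and vertices $\mathbf{x}_{ijk}=f_i\cap f_j\cap f_k$, $i\in\{0,1\}$, $j\in\{2,3\}$, $k\in\{4,5\}$. $\nu_i$ is the outer unit normal to $f_i$ and $|f_i|$ its area. The reference cube is $\hat E=[0,1]^3$, with face $\hat f_{2k}$ in $\hat x_{k+1}=0$ and $\hat f_{2k+1}$ in $\hat x_{k+1}=1$, and vertices $\hat{\mathbf{x}}_{ijk}=\hat f_i\cap\hat f_j\cap\hat f_k$. $F_E:\hat E\to E$ is the trilinear map with $F_E(\hat{\mathbf{x}}_{ijk})=\mathbf{x}_{ijk}$. It is a bijection with $F_E(\hat f_i)=f_i$, and the labelling is such that $J_E:=\det DF_E>0$. The Piola transform is $\mathcal{P}_E(\hat{\mathbf{v}})(\mathbf{x})=\frac{1}{J_E}DF_E\,\hat{\mathbf{v}}(\hat{\mathbf{x}})$,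 $\mathbf{x}=F_E(\hat{\mathbf{x}})$. For face 1, let $K_1(\hat x_2,\hat x_3)=\|\partial_{\hat x_2}F_E\times\partial_{\hat x_3}F_E\|$ at $\hat x_1=1$, which is a polynomial of degree at most 1 in each variable since the face is flat; write $$K_1=\alpha_{00}+\sum_{0\le p,q\le1,\ p+q\ge1}\alpha_{pq}\Big(\hat x_2^p\hat x_3^q-\frac1{(p+1)(q+1)}\Big)$$ and define $\hat\sigma^1=\sum_{p,q=0}^1\alpha_{pq}\hat\psi_{p,q}$, where $\hat\psi_{0,0}=(\hat x_1,0,0)^T$ and, for $p+q\ge1$, $\hat\psi_{p,q}$ has the components $$\hat x_1\hat x_2^p\hat x_3^q-\tfrac{\hat x_1}{(p+1)(q+1)},\quad \tfrac1{2(p+1)}\hat x_2(1-\hat x_2^p)\big(\hat x_3^q+\tfrac1{q+1}\big),\quad \tfrac1{2(q+1)}\hat x_3(1-\hat x_3^q)\big(\hat x_2^p+\tfrac1{p+1}\big).$$ The functions $\hat\sigma^3$ and $\hat\sigma^5$ are defined in the same way for faces 3 and 5 (where $\hat x_2=1$, resp. $\hat x_3=1$), interchanging the role of $\hat x_1$ (variable and vector component) with that of $\hat x_2$, resp. $\hat x_3$, and using the corresponding face Jacobians $K_3$, $K_5$. The supplements are $$\sigma^{i,j}=\mathcal{P}_E\Big(\frac{\hat\sigma^i}{|f_i|}-\frac{\hat\sigma^j}{|f_j|}\Big).$$ *)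

(* Defs.v *)
From HB Require Import structures.
From mathcomp Require Export all_boot all_order all_algebra perm.
From mathcomp Require Export all_classical all_reals all_analysis.
Export Order.TTheory GRing.Theory Num.Theory.
Export numFieldNormedType.Exports.

Set Implicit Arguments.
Unset Strict Implicit.
Unset Printing Implicit Defensive.

Local Open Scope classical_set_scope.
Local Open Scope ring_scope.

Section Euclidean.
Variable R : realType.

(* The norm that the library puts on 'rV[R]_3 is the sup norm, so the Euclidean
   structure is defined here. *)
Definition dot (u v : 'rV[R]_3) : R := (u *m v^T) 0 0.

Definition enorm (u : 'rV[R]_3) : R := Num.sqrt (dot u u).

(* Indices live in 'I_3 = Z/3, so this is the cyclic formula
   w_k = u_{k+1} v_{k+2} - u_{k+2} v_{k+1}. *)
Definition cross (u v : 'rV[R]_3) : 'rV[R]_3 :=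
  \row_(k < 3) (u 0 (k + 1) * v 0 (k + 2) - u 0 (k + 2) * v 0 (k + 1)).

Definition row3 (a b c : R) : 'rV[R]_3 := \row_(k < 3) [:: a; b; c]`_k.

Definition conv_hull (I : finType) (p : I -> 'rV[R]_3) : set 'rV[R]_3 :=
  [set \sum_i t i *: p i | t in
    [set t : I -> R | (forall i, 0 <= t i) /\ \sum_i t i = 1]].

(* (o, u, w) is a Cartesian coordinate system of a plane containing A. *)
Definition planar_frame (A : set 'rV[R]_3)
    (e : 'rV[R]_3 * 'rV[R]_3 * 'rV[R]_3) : Prop :=
  let: (o, u, w) := e in
  [/\ dot u u = 1, dot w w = 1, dot u w = 0 &
      A `<=` [set o + st.1 *: u + st.2 *: w | st in [set: R * R]]].

(* Two-dimensional Lebesgue measure of a planar set A, read in a Cartesian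
   coordinate system of its plane. *)
Definition area (A : set 'rV[R]_3) : R :=
  let: (o, u, w) := get (planar_frame A) in
  fine ((@lebesgue_measure R \x @lebesgue_measure R)%E
    [set st : R * R | A (o + st.1 *: u + st.2 *: w)]).

End Euclidean.

(* Face number 2k + b, with k : 'I_3 and b : bool, has axis k and side b. *)
Definition axis (i : 'I_6) : 'I_3 := inord i./2.
Definition side (i : 'I_6) : bool := odd i.

(* A vertex is indexed by the sides it lies on: x_{ijk}, with i = b_0,
   j = 2 + b_1, k = 4 + b_2, has index (b_0, b_1, b_2).

   The body is the convex hull of eight points, and each of the six faces is cut
   out by a supporting plane, with outer unit normal [normal i], that contains
   exactly the four vertices prescribed by the cube.  It follows that the eight
   points are the (distinct) extreme points of the body, that the six faces are
   convex quadrilaterals, any two adjacent ones sharing an edge, hence that they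
   are all the facets of the body, which has nonempty interior, and that
   x_{ijk} is the only common point of f_i, f_j and f_k. *)
Record hexahedron (R : realType) := Hexahedron {
  body : set 'rV[R]_3;
  face : 'I_6 -> set 'rV[R]_3;
  normal : 'I_6 -> 'rV[R]_3;
  vertex : {ffun 'I_3 -> bool} -> 'rV[R]_3;
  body_hull : body = conv_hull vertex;
  normal_unit : forall i, enorm (normal i) = 1;
  face_support : forall i, exists d : R,
    body `<=` [set x | dot x (normal i) <= d] /\
    face i = body `&` [set x | dot x (normal i) = d];
  face_vertex : forall i b, face i (vertex b) <-> b (axis i) = side i }.

Section Supplements.
Variables (R : realType) (E : hexahedron R).

Definition x024 : 'rV[R]_3 := vertex E [ffun=> false].

Definition ref_cube : set 'rV[R]_3 := [set xh | forall k, 0 <= xh 0 k <= 1].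

(* The trilinear map F_E, as the interpolant of the vertices. *)
Definition tri_map (xh : 'rV[R]_3) : 'rV[R]_3 :=
  \sum_(b : {ffun 'I_3 -> bool})
    (\prod_(k < 3) (if b k then xh 0 k else 1 - xh 0 k)) *: vertex E b.

Definition tri_map_inv : 'rV[R]_3 -> 'rV[R]_3 :=
  'pinv_(fun=> 0) ref_cube tri_map.

(* [jacobian] acts on row vectors from the right, that is, it is the transpose
   of DF_E: ['D_v F x = v *m 'J F x]. *)
Definition jac (xh : 'rV[R]_3) : R := \det ('J tri_map xh).

Definition piola (vh : 'rV[R]_3 -> 'rV[R]_3) (x : body E) : 'rV[R]_3 :=
  let xh := tri_map_inv (set_val x) in
  (jac xh)^-1 *: (vh xh *m 'J tri_map xh).

Definition partial (k : 'I_3) (xh : 'rV[R]_3) : 'rV[R]_3 :=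
  'D_(delta_mx 0 k) tri_map xh.

(* The objects attached to the faces 1, 3, 5 (axes 0, 1, 2) are written for face
   1 and transported by [xcol 0 (axis i)], the interchange of the coordinates 0
   and [axis i].  Thus the arguments (s, t) of K_i are (x_2, x_3) for i = 1,
   (x_1, x_3) for i = 3 and (x_2, x_1) for i = 5. *)
Definition face_jac (i : 'I_6) (s t : R) : R :=
  let xh := xcol 0 (axis i) (row3 1 s t) in
  enorm (cross (partial (tperm 0 (axis i) 1) xh)
               (partial (tperm 0 (axis i) 2) xh)).

(* The coefficients alpha_{pq} of K_i; they are unique, and they exist because
   K_i is a polynomial of degree at most 1 in each variable. *)
Definition face_jac_coef (i : 'I_6) : 'M[R]_2 :=
  get [set a : 'M[R]_2 | forall s t, 0 <= s <= 1 -> 0 <= t <= 1 ->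
    face_jac i s t = a 0 0 +
      \sum_(p < 2) \sum_(q < 2 | (1 <= p + q)%N)
        a p q * (s ^+ p * t ^+ q - 1 / (p.+1%:R * q.+1%:R))].

Definition psi (p q : nat) (x : 'rV[R]_3) : 'rV[R]_3 :=
  let x1 := x 0 0 in let x2 := x 0 1 in let x3 := x 0 2 in
  if (p + q == 0)%N then row3 x1 0 0
  else row3
    (x1 * x2 ^+ p * x3 ^+ q - x1 / (p.+1%:R * q.+1%:R))
    (1 / (2 * p.+1%:R) * x2 * (1 - x2 ^+ p) * (x3 ^+ q + 1 / q.+1%:R))
    (1 / (2 * q.+1%:R) * x3 * (1 - x3 ^+ q) * (x2 ^+ p + 1 / p.+1%:R)).

Definition ref_sigma (i : 'I_6) (xh : 'rV[R]_3) : 'rV[R]_3 :=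
  xcol 0 (axis i) (\sum_(p < 2) \sum_(q < 2)
    face_jac_coef i p q *: psi p q (xcol 0 (axis i) xh)).

Definition sigma (i j : 'I_6) : body E -> 'rV[R]_3 :=
  piola (fun xh => (area (face E i))^-1 *: ref_sigma i xh
                   - (area (face E j))^-1 *: ref_sigma j xh).

Definition constants : set (body E -> 'rV[R]_3) :=
  [set (fun=> c) | c in [set: 'rV[R]_3]].

Definition radials : set (body E -> 'rV[R]_3) :=
  [set (fun x => a *: set_val x) | a in [set: R]].

Definition supplements : set (body E -> 'rV[R]_3) :=
  [set ab.1 *: sigma 1 3 + ab.2 *: sigma 3 5 | ab in [set: R * R]].

Definition V0 : set (body E -> 'rV[R]_3) :=
  [set v | exists v1 v2 v3,
    [/\ constants v1, radials v2, supplements v3 & v = v1 + v2 + v3]].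

Definition flux_on (i : 'I_6) (v : body E -> 'rV[R]_3) (c : R) : Prop :=
  forall x : body E, face E i (set_val x) -> dot (v x) (normal E i) = c.

(* The vector of the six constant normal fluxes, meaningful when they are
   constant. *)
Definition fluxes (v : body E -> 'rV[R]_3) : 'rV[R]_6 :=
  \row_(i < 6) get (flux_on i v).

Definition shifted_pos (x : body E) : 'rV[R]_3 := set_val x - x024.

Definition height (i : 'I_6) : R := fluxes shifted_pos 0 i.

Let alpha := height 1.
Let beta := height 3.
Let gamma := height 5.
Let a1 := area (face E 1).
Let a3 := area (face E 3).
Let a5 := area (face E 5).
Let D := a1 * alpha + a3 * beta + a5 * gamma.

Definition phi1 : body E -> 'rV[R]_3 := (a1 / D) *:
  (shifted_pos + (a3 * beta + a5 * gamma) *: sigma 1 3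
               + (a5 * gamma) *: sigma 3 5).

Definition phi3 : body E -> 'rV[R]_3 := (a3 / D) *:
  (shifted_pos - (a1 * alpha) *: sigma 1 3 + (a5 * gamma) *: sigma 3 5).

Definition phi5 : body E -> 'rV[R]_3 := (a5 / D) *:
  (shifted_pos - (a1 * alpha) *: sigma 1 3
               - (a1 * alpha + a3 * beta) *: sigma 3 5).

Definition phi_even (i : 'I_6) (n : 'rV[R]_3) (x : body E) : 'rV[R]_3 :=
  (dot n (normal E i))^-1 *:
  (n - dot n (normal E 1) *: phi1 x - dot n (normal E 3) *: phi3 x
     - dot n (normal E 5) *: phi5 x).

Definition phi (i : 'I_6) : body E -> 'rV[R]_3 :=
  [:: phi_even 0 (cross (normal E 2) (normal E 4)); phi1;
      phi_even 2 (cross (normal E 0) (normal E 4)); phi3;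
      phi_even 4 (cross (normal E 0) (normal E 2)); phi5 ]`_i.

End Supplements.

(* Main.v *)
Require Import Defs.
From mathcomp Require Import measurable_realfun ring lra.

Set Implicit Arguments.
Unset Strict Implicit.
Unset Printing Implicit Defensive.

Local Open Scope classical_set_scope.
Local Open Scope ring_scope.

(** Everything follows from one computation: the Piola image of [ref_sigma i],
    for i = 1, 3, 5, has normal flux 1 on face i and 0 on the other five faces.

    Let face j have axis k.  At a point of the reference face the derivatives of
    F in the two directions other than k are tangent to the flat face j, so the
    normal component of [v *m 'J F] is [v_k] times that of the derivative in
    direction k.  The Jacobian factors in the same way, as this normal component
    times [face_orient j], the signed area density of the face.  Hence the normal
    flux of the Piola image of v is [v_k / face_orient j] ([flux_piola]).  On its
    own face the density is K_i, which is also the value of the relevant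
    component of [ref_sigma i]; on the other faces that component vanishes
    ([ref_sigma_own], [ref_sigma_other]).  So sigma^{1,3} has fluxes 1/|f_1| and
    -1/|f_3| on faces 1 and 3 and 0 elsewhere, and likewise for sigma^{3,5}
    ([flux_sigma]).

    The Piola transform is evaluated through an inverse of F, so this requires
    each point of a face to be the image of a point of the reference face.  A
    bilinear map onto a convex quadrilateral is onto: the segments joining
    opposite points of two opposite sides sweep the quadrilateral, by the
    intermediate value theorem ([face_onto]).  The same argument shows that a face
    is cut out of its plane by four half planes, whence it is measurable and has
    positive area ([area_gt0]).

    Constants and the position field have constant fluxes because the faces are
    flat, so the six fluxes of an element [c + a x + p sigma^{1,3} + q sigma^{3,5}]
    are six linear forms in (c, a, p, q).  If they vanish, the even faces, which
    meet at x_024 with independent normals ([even_normals_free]), give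
    [c = - a x_024]; the odd ones, weighted by the areas and added, give
    [a D = 0] with D > 0, and then p = q = 0 ([vec_flux_inj]).  The functions
    [phi i] have fluxes [delta_ij] ([flux_phi]) and prove surjectivity. *)

(** * Dot and cross products in three dimensions *)

Section VectorAlgebra.
Variable R : realType.
Implicit Types (u v w n y q : 'rV[R]_3) (a : R).

Lemma ord3_cases (P : 'I_3 -> Prop) : P 0 -> P 1 -> P 2 -> forall k, P k.
Proof.
move=> P0 P1 P2 [[|[|[|//]]] lt_k3].
- by rewrite (_ : Ordinal lt_k3 = 0) //; apply: val_inj.
- by rewrite (_ : Ordinal lt_k3 = 1) //; apply: val_inj.
- by rewrite (_ : Ordinal lt_k3 = 2) //; apply: val_inj.
Qed.

Lemma ord3_addE : ((1 + 1 = 2 :> 'I_3) * (1 + 2 = 0 :> 'I_3)) *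
  ((2 + 1 = 0 :> 'I_3) * (2 + 2 = 1 :> 'I_3)).
Proof. by do !split; apply: val_inj. Qed.

Lemma sum_ord3 (V : nmodType) (f : 'I_3 -> V) : \sum_k f k = f 0 + f 1 + f 2.
Proof.
rewrite 3!big_ord_recl big_ord0 addr0 addrA.
by congr (f _ + f _ + f _); apply: val_inj.
Qed.

Lemma dotE u v : dot u v = u 0 0 * v 0 0 + u 0 1 * v 0 1 + u 0 2 * v 0 2.
Proof. by rewrite /dot mxE sum_ord3 !mxE. Qed.

Lemma cross0 u v : cross u v 0 0 = u 0 1 * v 0 2 - u 0 2 * v 0 1.
Proof. rewrite mxE !add0r. reflexivity. Qed.

Lemma cross1 u v : cross u v 0 1 = u 0 2 * v 0 0 - u 0 0 * v 0 2.
Proof.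
by rewrite mxE !ord3_addE.
Qed.

Lemma cross2 u v : cross u v 0 2 = u 0 0 * v 0 1 - u 0 1 * v 0 0.
Proof.
by rewrite mxE !ord3_addE.
Qed.

Lemma addvE u v k : (u + v) 0 k = u 0 k + v 0 k. Proof. exact: mxE. Qed.

Lemma oppvE u k : (- u) 0 k = - u 0 k. Proof. exact: mxE. Qed.

Lemma scalevE a u k : (a *: u) 0 k = a * u 0 k. Proof. exact: mxE. Qed.

Lemma zerovE k : (0 : 'rV[R]_3) 0 k = 0. Proof. exact: mxE. Qed.

Definition coordE :=
  (cross0, cross1, cross2, dotE, addvE, oppvE, scalevE, zerovE).

Lemma rV3P u v : u 0 0 = v 0 0 -> u 0 1 = v 0 1 -> u 0 2 = v 0 2 -> u = v.
Proof. by move=> *; apply/rowP; apply: ord3_cases. Qed.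

Lemma dotDl u v n : dot (u + v) n = dot u n + dot v n.
Proof. by rewrite !coordE; ring. Qed.

Lemma dotBl u v n : dot (u - v) n = dot u n - dot v n.
Proof. by rewrite !coordE; ring. Qed.

Lemma dotZl a u n : dot (a *: u) n = a * dot u n.
Proof. by rewrite !coordE; ring. Qed.

Lemma dot0l n : dot 0 n = 0.
Proof. by rewrite dotE !mxE !mul0r !addr0. Qed.

Lemma dotC u v : dot u v = dot v u.
Proof. by rewrite !dotE; ring. Qed.

Lemma dot_suml (I : finType) (f : I -> 'rV[R]_3) n :
  dot (\sum_i f i) n = \sum_i dot (f i) n.
Proof.
by elim/big_rec2: _ => [|i a u _ <-]; [exact: dot0l | exact: dotDl].
Qed.

Lemma dot_ge0 u : 0 <= dot u u.
Proof. by rewrite dotE -!expr2 !addr_ge0 ?sqr_ge0. Qed.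

Lemma dot_eq0 u : dot u u = 0 -> u = 0.
Proof.
rewrite dotE => u0; apply: rV3P; rewrite mxE; nra.
Qed.

Lemma enorm_unit u : enorm u = 1 -> dot u u = 1.
Proof. by move=> u1; rewrite -[LHS]sqr_sqrtr ?dot_ge0 // -/(enorm u) u1 expr1n. Qed.

Lemma enormZ_unit a n : dot n n = 1 -> enorm (a *: n) = `|a|.
Proof.
move=> n1; rewrite /enorm dotZl dotC dotZl n1 mulr1 -expr2; exact: sqrtr_sqr.
Qed.

Lemma cross_anti u v : cross u v = - cross v u.
Proof. by apply: rV3P; rewrite !coordE; ring. Qed.

Lemma crossDl u v w : cross (u + v) w = cross u w + cross v w.
Proof. by apply: rV3P; rewrite !coordE; ring. Qed.

Lemma crossZl a u w : cross (a *: u) w = a *: cross u w.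
Proof. by apply: rV3P; rewrite !coordE; ring. Qed.

Lemma crossDr u v w : cross w (u + v) = cross w u + cross w v.
Proof. by apply: rV3P; rewrite !coordE; ring. Qed.

Lemma crossZr a u w : cross w (a *: u) = a *: cross w u.
Proof. by apply: rV3P; rewrite !coordE; ring. Qed.

Lemma dot_cross_mixl a u v w n :
  dot (cross ((1 - a) *: u + a *: v) w) n =
  (1 - a) * dot (cross u w) n + a * dot (cross v w) n.
Proof. by rewrite crossDl !crossZl dotDl !dotZl. Qed.

Lemma dot_cross_mixr a u v w n :
  dot (cross w ((1 - a) *: u + a *: v)) n =
  (1 - a) * dot (cross w u) n + a * dot (cross w v) n.
Proof. by rewrite crossDr !crossZr dotDl !dotZl. Qed.

Lemma dot_cross_shift a u v w n :
  dot (cross (u - a *: v) w) n = dot (cross u w) n - a * dot (cross v w) n.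
Proof. by rewrite -scaleNr crossDl crossZl dotDl dotZl mulNr. Qed.

Lemma enormN u : enorm (- u) = enorm u.
Proof. by rewrite /enorm !coordE; congr Num.sqrt; ring. Qed.

(** The triple product may start at any row, since the cross product is
    cyclic in the indices modulo 3. *)
Lemma det_cross (M : 'M[R]_3) k :
  \det M = dot (row k M) (cross (row (k + 1) M) (row (k + 2) M)).
Proof.
have -> : \det M = dot (row 0 M) (cross (row 1 M) (row 2 M)).
  pose m i j := M (inord i) (inord j).
  have mE i j : M i j = m i j by rewrite /m !inord_val.
  rewrite !coordE !mxE !mE !(expand_det_row _ 0) !big_ord_recl big_ord0.
  rewrite /cofactor !(expand_det_row _ 0) !big_ord_recl !big_ord0 /cofactor.
  rewrite !det_mx11 !mxE !mE /= /bump /=.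
  ring.
by elim/ord3_cases: k; rewrite ?add0r ?ord3_addE // !coordE !mxE; ring.
Qed.

(** The component of a vector u x v orthogonal to n comes from
    n x (n x (u x v)), and (u x v) x n is a combination of u and v with the
    coefficients u.n and v.n. *)
Lemma cross_perp u v n : dot n n = 1 -> dot u n = 0 -> dot v n = 0 ->
  cross u v = dot (cross u v) n *: n.
Proof.
move=> n1 un vn.
have -> : cross u v = dot n n *: cross u v by rewrite n1 scale1r.
have lag : dot n n *: cross u v - dot (dot n n *: cross u v) n *: n =
   cross n (dot u n *: v - dot v n *: u) + (1 - dot n n) *: (dot (cross u v) n *: n).
  by apply: rV3P; rewrite !coordE; ring.
move: lag; rewrite un vn n1 subrr !scale0r subrr addr0 => lag.
apply/eqP; rewrite -subr_eq0 lag; apply/eqP.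
by apply: rV3P; rewrite !coordE; ring.
Qed.

(** In the plane orthogonal to n, the forms [fun y => dot (cross y q) n] and
    [fun y => dot y n'] both vanish on q, so they are proportional; the identity
    compares their values at y and u. *)
Lemma dot_cross_switch y u q n n' : dot n n = 1 ->
  dot y n = 0 -> dot u n = 0 -> dot q n = 0 -> dot q n' = 0 ->
  dot (cross y q) n * dot u n' = dot y n' * dot (cross u q) n.
Proof.
move=> n1 yn un qn qn'.
have yuq : dot (cross y u) q = 0.
  by rewrite (cross_perp n1 yn un) dotZl (dotC n) qn mulr0.
have : dot y n' * dot (cross u q) n - dot u n' * dot (cross y q) n
     + dot q n' * dot (cross y u) n - dot n n' * dot (cross y u) q = 0.
  by rewrite !coordE; ring.
rewrite qn' yuq mul0r mulr0 addr0 subr0 => /eqP; rewrite subr_eq0 => /eqP ->.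
by rewrite mulrC.
Qed.

Lemma perp_collinear y q n : dot n n = 1 -> dot y n = 0 -> dot q n = 0 ->
  q != 0 -> dot (cross y q) n = 0 -> y = (dot y q / dot q q) *: q.
Proof.
move=> n1 yn qn q0 yqn; have yq0 := cross_perp n1 yn qn.
rewrite yqn scale0r in yq0.
have qq0 : dot q q != 0 by apply: contra_neq q0 => /dot_eq0.
apply: (scalerI qq0); rewrite scalerA mulrCA divff // mulr1.
have -> : dot q q *: y = dot y q *: q + cross q (cross y q).
  by apply: rV3P; rewrite !coordE; ring.
by rewrite yq0; apply: rV3P; rewrite !coordE; ring.
Qed.

End VectorAlgebra.

(** * The trilinear map and its derivative *)

Section Weights.
Variable R : realType.
Implicit Types (x : 'rV[R]_3) (b : {ffun 'I_3 -> bool}) (k l m : 'I_3) (c : R).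

Definition weight b x : R := \prod_(k < 3) (if b k then x 0 k else 1 - x 0 k).

Definition upd x l c : 'rV[R]_3 := \row_k (if k == l then c else x 0 k).

Lemma upd_same x l c : upd x l c 0 l = c.
Proof. by rewrite mxE eqxx. Qed.

Lemma upd_other x l c k : k != l -> upd x l c 0 k = x 0 k.
Proof. by rewrite mxE => /negPf ->. Qed.

Lemma upd_id x l : upd x l (x 0 l) = x.
Proof. by apply/rowP => k; rewrite mxE; case: eqP => [->|]. Qed.

Lemma upd_upd x l c d : upd (upd x l c) l d = upd x l d.
Proof. by apply/rowP => k; rewrite !mxE; case: eqP. Qed.

Lemma updC x l m c d : l != m -> upd (upd x l c) m d = upd (upd x m d) l c.
Proof.
move=> lm; apply/rowP => k; rewrite !mxE.
by case: eqP => [->|] //; rewrite eq_sym (negPf lm).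
Qed.

Lemma upd_cube x l c : ref_cube x -> 0 <= c <= 1 -> ref_cube (upd x l c).
Proof. by move=> cx c01 k; rewrite mxE; case: eqP. Qed.

Lemma weight_upd b x l c :
  weight b (upd x l c) =
  (1 - c) * weight b (upd x l 0) + c * weight b (upd x l 1).
Proof.
have factor d : weight b (upd x l d) = (if b l then d else 1 - d) *
  \prod_(k < 3 | k != l) (if b k then x 0 k else 1 - x 0 k).
  rewrite /weight (bigD1 l) //= upd_same; congr (_ * _).
  by apply: eq_bigr => k kl; rewrite upd_other.
by rewrite !factor; case: (b l); ring.
Qed.

Lemma weight_ge0 b x : ref_cube x -> 0 <= weight b x.
Proof.
move=> cx; apply: prodr_ge0 => k _; have /andP[x0 x1] := cx k.
by case: ifP => // _; rewrite subr_ge0.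
Qed.

Lemma weight_sum x : \sum_b weight b x = 1.
Proof.
rewrite /weight -(bigA_distr_bigA (fun k j => if j then x 0 k else 1 - x 0 k)).
by apply: big1 => k _; rewrite big_bool /=; ring.
Qed.

Lemma weight_off b x k : x 0 k = (~~ b k)%:R -> weight b x = 0.
Proof.
move=> xk; rewrite /weight (bigD1 k) //= xk.
by case: (b k) => /=; rewrite ?subrr mul0r.
Qed.

End Weights.

Section Trilinear.
Variables (R : realType) (E : hexahedron R).
Implicit Types (x : 'rV[R]_3) (k l m : 'I_3) (c : R).

(** The derivative of the trilinear map in direction l: F is affine in each
    coordinate, so this is the difference between the two opposite faces, and it
    does not depend on the coordinate l of x. *)
Definition edge l x := tri_map E (upd x l 1) - tri_map E (upd x l 0).

Lemma tri_upd x l c : tri_map E (upd x l c) =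
  tri_map E (upd x l 0) + c *: edge l x.
Proof.
rewrite /edge scalerBr addrCA -[X in _ = _ + (X - _)]scale1r -scalerBl.
rewrite [RHS]addrC /tri_map !scaler_sumr -big_split /=; apply: eq_bigr => b _.
by rewrite !scalerA -scalerDl -/(weight _ _) weight_upd.
Qed.

Lemma edge_upd_same x l c : edge l (upd x l c) = edge l x.
Proof. by rewrite /edge !upd_upd. Qed.

Lemma edge_upd x l m c : l != m -> edge l (upd x m c) =
  (1 - c) *: edge l (upd x m 0) + c *: edge l (upd x m 1).
Proof.
move=> lm; have ml : m != l by rewrite eq_sym.
rewrite /edge !(updC _ _ _ ml) !(tri_upd _ m c) /edge.
by apply/rowP => k; rewrite !mxE; ring.
Qed.

Lemma tri_differentiable x : differentiable (tri_map E) x.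
Proof.
have wdiff b : differentiable (weight b : 'rV[R]_3 -> R) x.
  have -> : weight b = fun y : 'rV[R]_3 =>
      (if b 0 then y 0 0 else 1 - y 0 0) * (if b 1 then y 0 1 else 1 - y 0 1)
      * (if b 2 then y 0 2 else 1 - y 0 2).
    apply/funext => y; rewrite /weight !big_ord_recl big_ord0 mulr1 mulrA.
    by congr (_ * _ * _); congr (if b _ then y _ _ else 1 - y _ _); apply: val_inj.
  have fdiff k : differentiable
      (fun y : 'rV[R]_3 => if b k then y 0 k else 1 - y 0 k) x.
    case: (b k); first exact: differentiable_coord.
    apply: differentiableB; first exact: differentiable_cst.
    exact: differentiable_coord.
  by apply: differentiableM; first apply: differentiableM.
have -> : tri_map E = \sum_b (fun y : 'rV[R]_3 => weight b y *: vertex E b).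
  by apply/funext => y; rewrite fct_sumE.
elim/big_ind: _ => [|f g df dg|b _]; first exact: (differentiable_cst 0).
  exact: differentiableD.
exact: differentiableZl.
Qed.

(** The difference quotients in a coordinate direction are constant, because
    F is affine in each coordinate. *)
Lemma partialE k x : partial E k x = edge k x.
Proof.
have shift h : tri_map E (h *: delta_mx 0 k + x) =
    tri_map E x + h *: edge k x.
  have -> : h *: delta_mx 0 k + x = upd x k (x 0 k + h).
    apply/rowP => j; rewrite !mxE eqxx eq_sym /=.
    by case: eqP => [->|]; rewrite /= ?mulr1 ?mulr0 ?add0r // addrC.
  rewrite tri_upd -[X in _ = tri_map E X + _](upd_id x k) (tri_upd x k (x 0 k)).
  by rewrite scalerDl addrA.
rewrite /partial deriveE; last exact: tri_differentiable.
rewrite -deriveE; last exact: tri_differentiable.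
apply: cvg_lim => //.
apply: (@cvg_trans _ ((fun=> edge k x) @ (0 : R)^')); last exact: cvg_cst.
apply: near_eq_cvg; near=> h.
rewrite /= shift addrC addKr scalerA mulVf ?scale1r //.
by near: h; exact: nbhs_dnbhs_neq.
Unshelve. all: by end_near.
Qed.

Lemma row_jacobian k x : row k ('J (tri_map E) x) = edge k x.
Proof.
rewrite rowE -deriveEjacobian; first exact: partialE.
exact: tri_differentiable.
Qed.

(** The three choices of k give the same determinant; on a face, k is taken to
    be the axis of that face. *)
Lemma jac_cross k x : jac E x =
  dot (edge k x) (cross (edge (k + 1) x) (edge (k + 2) x)).
Proof. by rewrite /jac (det_cross _ k) !row_jacobian. Qed.

Lemma mulmx_jacobian v x :
  v *m 'J (tri_map E) x = \sum_k v 0 k *: edge k x.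
Proof.
by rewrite mulmx_sum_row; apply: eq_bigr => k _; rewrite row_jacobian.
Qed.

End Trilinear.

(** * Faces and their supporting planes *)

(** Face number 2k + b, inverse to the pair [axis], [side]. *)
Definition facet (k : 'I_3) (b : bool) : 'I_6 := inord (b + k.*2).

Lemma facet_lt (k : 'I_3) (b : bool) : (b + k.*2 < 6)%N.
Proof. by case: k b => [[|[|[|//]]] ?] []. Qed.

Lemma axis_facet k b : axis (facet k b) = k.
Proof.
by rewrite /axis /facet inordK ?facet_lt // half_bit_double inord_val.
Qed.

Lemma side_facet k b : side (facet k b) = b.
Proof. by rewrite /side /facet inordK ?facet_lt // oddD odd_double addbF oddb. Qed.

Lemma half_lt3 (i : 'I_6) : (i./2 < 3)%N.
Proof. by case: i => [[|[|[|[|[|[|//]]]]]] ?]. Qed.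

Lemma facet_id i : facet (axis i) (side i) = i.
Proof.
by rewrite /facet /axis /side inordK ?half_lt3 // odd_double_half inord_val.
Qed.

Lemma neq_succ1 (k : 'I_3) : k + 1 != k.
Proof. by elim/ord3_cases: k. Qed.

Lemma neq_succ2 (k : 'I_3) : k + 2 != k.
Proof. by elim/ord3_cases: k. Qed.

Lemma neq_succ12 (k : 'I_3) : k + 1 != k + 2.
Proof. by elim/ord3_cases: k. Qed.

Lemma axis_split (k l : 'I_3) : [\/ l = k, l = k + 1 | l = k + 2].
Proof.
elim/ord3_cases: k; elim/ord3_cases: l; try (by constructor 1; apply: val_inj);
  try (by constructor 2; apply: val_inj); by constructor 3; apply: val_inj.
Qed.

Section Faces.
Variables (R : realType) (E : hexahedron R).
Implicit Types (x y : 'rV[R]_3) (k l m : 'I_3) (i j : 'I_6) (c : R).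
Implicit Types (b : {ffun 'I_3 -> bool}).

Lemma normal1 i : dot (normal E i) (normal E i) = 1.
Proof. exact/enorm_unit/normal_unit. Qed.

Definition offset i : R := dot (vertex E [ffun=> side i]) (normal E i).

Lemma faceP i x : face E i x <-> body E x /\ dot x (normal E i) = offset i.
Proof.
have [d [_ fd]] := face_support E i.
have : face E i (vertex E [ffun=> side i]) by apply/face_vertex; rewrite ffunE.
by rewrite fd => -[_ /= od]; rewrite /offset od.
Qed.

Lemma body_le i x : body E x -> dot x (normal E i) <= offset i.
Proof.
have [d [bd fd]] := face_support E i.
have : face E i (vertex E [ffun=> side i]) by apply/face_vertex; rewrite ffunE.
by rewrite fd => -[_ /= od] /bd; rewrite /offset od.
Qed.

Lemma vertex_on i b : b (axis i) = side i -> dot (vertex E b) (normal E i) = offset i.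
Proof. by move/face_vertex/faceP => -[]. Qed.

Lemma vertex_body b : body E (vertex E b).
Proof.
have : face E (facet 0 (b 0)) (vertex E b).
  by apply/face_vertex; rewrite axis_facet side_facet.
by move/faceP => -[].
Qed.

Lemma vertex_lt i b : b (axis i) <> side i -> dot (vertex E b) (normal E i) < offset i.
Proof.
move=> bi; rewrite lt_neqAle body_le ?andbT; last exact: vertex_body.
apply: contra_notN bi => /eqP e.
by apply/face_vertex/faceP; split=> //; exact: vertex_body.
Qed.

Lemma tri_body x : ref_cube x -> body E (tri_map E x).
Proof.
move=> cx; rewrite body_hull; exists (fun b => weight b x) => //=; split.
  by move=> b; exact: weight_ge0.
exact: weight_sum.
Qed.

Lemma tri_gap i x : offset i - dot (tri_map E x) (normal E i) =
  \sum_b weight b x * (offset i - dot (vertex E b) (normal E i)).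
Proof.
rewrite -[X in X - _]mul1r -(weight_sum x) mulr_suml /tri_map dot_suml -sumrB.
by apply: eq_bigr => b _; rewrite dotZl mulrBr.
Qed.

Lemma tri_on i x : x 0 (axis i) = (side i)%:R ->
  dot (tri_map E x) (normal E i) = offset i.
Proof.
move=> xi; apply/eqP; rewrite eq_sym -subr_eq0 tri_gap; apply/eqP.
apply: big1 => b _; have [bi|bi] := eqVneq (b (axis i)) (side i).
  by rewrite vertex_on // subrr mulr0.
rewrite (@weight_off _ _ _ (axis i)) ?mul0r // xi.
by case: (side i) (b (axis i)) bi => [] [].
Qed.

(** The gap to the supporting plane is the mean of the gaps of the vertices, and
    some vertex outside the face has a positive weight. *)
Lemma tri_lt i x : ref_cube x -> x 0 (axis i) != (side i)%:R ->
  dot (tri_map E x) (normal E i) < offset i.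
Proof.
move=> cx xi; rewrite -subr_gt0 tri_gap.
(* A vertex off the face all of whose weight factors are nonzero. *)
pose b := [ffun k => if k == axis i then ~~ side i else x 0 k != 0].
rewrite (bigD1 b) //= ltr_pwDl //; last first.
  apply: sumr_ge0 => b' _; rewrite mulr_ge0 ?weight_ge0 ?subr_ge0 //.
  exact/body_le/vertex_body.
rewrite mulr_gt0 //; last first.
  by rewrite subr_gt0 vertex_lt // ffunE eqxx; case: (side i).
rewrite lt_neqAle eq_sym weight_ge0 // andbT; apply/prodf_neq0 => k _.
rewrite ffunE; have [->|_] := eqVneq k (axis i).
  by case: (side i) xi => //=; rewrite subr_eq0 eq_sym.
by have [->|//] := eqVneq (x 0 k) 0; rewrite subr0 oner_eq0.
Qed.

Lemma tri_face i x : ref_cube x -> face E i (tri_map E x) ->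
  x 0 (axis i) = (side i)%:R.
Proof.
move=> cx /faceP[_ e]; apply/eqP; apply: contra_eqT e => xi.
by rewrite lt_eqF // tri_lt.
Qed.

(** F maps the reference face into the supporting plane, also outside the
    cube, so that derivatives along the reference face are tangent. *)
Lemma edge_tangent i l x : l != axis i -> x 0 (axis i) = (side i)%:R ->
  dot (edge E l x) (normal E i) = 0.
Proof.
move=> li xi; have il : axis i != l by rewrite eq_sym.
by rewrite /edge dotBl !tri_on ?subrr ?upd_other.
Qed.

Lemma cube01 : (0 <= (0 : R) <= 1) * (0 <= (1 : R) <= 1).
Proof. by rewrite !lexx ler01. Qed.

Lemma edge_outward i x : side i -> ref_cube x ->
  0 < dot (edge E (axis i) x) (normal E i).
Proof.
move=> si cx; rewrite /edge dotBl subr_gt0 (@tri_on i (upd _ _ 1)) ?upd_same ?si //.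
by rewrite tri_lt ?upd_same ?si 1?eq_sym ?oner_eq0 //; apply: upd_cube; rewrite ?cube01.
Qed.

Lemma edge_inward i x : ~~ side i -> ref_cube x ->
  dot (edge E (axis i) x) (normal E i) < 0.
Proof.
move=> /negPf si cx; rewrite /edge dotBl subr_lt0 (@tri_on i (upd _ _ 0)) ?upd_same ?si //.
by rewrite tri_lt ?upd_same ?si ?oner_eq0 //; apply: upd_cube; rewrite ?cube01.
Qed.

(** The signed area density of the restriction of F to face i, with respect to
    the outer normal. *)
Definition face_orient i x : R :=
  dot (cross (edge E (axis i + 1) x) (edge E (axis i + 2) x)) (normal E i).

Lemma face_orient_upd i l c x : l != axis i -> face_orient i (upd x l c) =
  (1 - c) * face_orient i (upd x l 0) + c * face_orient i (upd x l 1).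
Proof.
rewrite /face_orient; case: (axis_split (axis i) l) => ->; first by rewrite eqxx.
  move=> _; rewrite !edge_upd_same (edge_upd _ _ c); last by rewrite eq_sym neq_succ12.
  exact: dot_cross_mixr.
move=> _; rewrite !edge_upd_same (edge_upd _ _ c); last by rewrite neq_succ12.
exact: dot_cross_mixl.
Qed.

Lemma face_cross i x : x 0 (axis i) = (side i)%:R ->
  cross (edge E (axis i + 1) x) (edge E (axis i + 2) x) =
  face_orient i x *: normal E i.
Proof.
move=> xi; apply: cross_perp; first exact: normal1.
  by rewrite edge_tangent ?neq_succ1.
by rewrite edge_tangent ?neq_succ2.
Qed.

(** The volume of the parallelepiped is base times height: two of its edges
    are tangent to the face, so only the normal part of the third counts. *)
Lemma jac_face i x : x 0 (axis i) = (side i)%:R ->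
  jac E x = dot (edge E (axis i) x) (normal E i) * face_orient i x.
Proof.
move=> xi; rewrite (jac_cross _ (axis i)) face_cross // dotC dotZl mulrC.
by rewrite dotC.
Qed.

Hypothesis jac_gt0 : forall x, ref_cube x -> 0 < jac E x.

Lemma face_orient_gt0 i x : side i -> ref_cube x -> x 0 (axis i) = (side i)%:R ->
  0 < face_orient i x.
Proof.
move=> si cx xi; have := jac_gt0 cx; rewrite (jac_face xi).
by rewrite pmulr_rgt0 // edge_outward.
Qed.

Lemma face_orient_lt0 i x : ~~ side i -> ref_cube x -> x 0 (axis i) = (side i)%:R ->
  face_orient i x < 0.
Proof.
move=> si cx xi; have := jac_gt0 cx; rewrite (jac_face xi).
by rewrite nmulr_rgt0 // edge_inward.
Qed.

Lemma face_orient_same i x y : ref_cube x -> ref_cube y ->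
  x 0 (axis i) = (side i)%:R -> y 0 (axis i) = (side i)%:R ->
  0 < face_orient i x * face_orient i y.
Proof.
case: (boolP (side i)) => si cx cy xi yi.
  by rewrite mulr_gt0 // face_orient_gt0 ?si.
by rewrite nmulr_lgt0 face_orient_lt0 // (negPf si).
Qed.

(** Intermediate value theorem on [0, 1]; the hypothesis says that the values
    at 0 and at 1 do not have the same strict sign. *)
Lemma quadratic_root (a b c : R) : a * (a + b + c) <= 0 ->
  exists2 s, 0 <= s <= 1 & a + b * s + c * s ^+ 2 = 0.
Proof.
move=> sgn.
wlog a0 : a b c sgn / a <= 0.
  move=> W; have [|/ltW a0] := lerP a 0; first exact: W.
  have [||s s01 e] := W (- a) (- b) (- c);
    [by rewrite -!opprD mulrNN | by rewrite oppr_le0 |].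
  by exists s => //; move: e; rewrite !mulNr -!opprD => /eqP; rewrite oppr_eq0 => /eqP.
have [->|an0] := eqVneq a 0; first by exists 0; rewrite ?lexx ?ler01 //; ring.
pose p : {poly R} := a%:P + b *: 'X + c *: 'X^2.
have pE s : p.[s] = a + b * s + c * s ^+ 2 by rewrite !hornerE.
have abc0 : 0 <= a + b + c by rewrite -(@nmulr_rle0 _ a) // lt_neqAle an0.
have [||s s01 /rootP ps] := @poly_ivt R p 0 1; first exact: ler01.
  by rewrite !pE; apply/andP; split; nra.
by exists s; rewrite // -pE.
Qed.

(** For s in [0, 1] let P(s) and P(s) + q(s) be the points with parameter s on
    two opposite sides of the face.  The signed area spanned by x - P(s) and q(s)
    is quadratic in s.  At s = 0 and s = 1 the vector q(s) lies on one of the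
    other two sides, and x is on the inner side of both, so that the signed areas
    have opposite signs there.  For an s where it vanishes, x = P(s) + t q(s),
    and t is in [0, 1] because x is on the inner sides of the first two sides. *)
Lemma face_onto i x : dot x (normal E i) = offset i ->
  (forall j, axis j != axis i -> dot x (normal E j) <= offset j) ->
  exists2 xh, ref_cube xh & tri_map E xh = x.
Proof.
move=> xi xj; set k := axis i; set n := normal E i; pose l := k + 1; pose m := k + 2.
have lk : l != k := neq_succ1 k; have mk : m != k := neq_succ2 k.
have lm : l != m := neq_succ12 k; have ml : m != l by rewrite eq_sym.
(* The corner of the reference face at which its two free coordinates vanish. *)
pose o : 'rV[R]_3 := \row_j (if j == k then (side i)%:R else 0).
have co : ref_cube o.
  by move=> j; rewrite mxE; case: (j == k) (side i) => [] []; rewrite ?cube01.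
have y_cube s : 0 <= s <= 1 -> ref_cube (upd o l s) by exact: upd_cube.
have y_k s : upd o l s 0 k = (side i)%:R.
  by rewrite upd_other 1?eq_sym // mxE eqxx.
have y_m s : upd (upd o l s) m 0 = upd o l s.
  rewrite -[RHS](upd_id _ m); congr upd.
  by rewrite upd_other // mxE (negPf mk).
pose p s := tri_map E (upd o l s); pose q s := edge E m (upd o l s).
pose u := edge E l o.
have pE s : p s = p 0 + s *: u by rewrite /p tri_upd.
have qE s : q s = (1 - s) *: q 0 + s *: q 1 by rewrite /q edge_upd.
have y_n s : dot (x - p s) n = 0 by rewrite dotBl xi /p tri_on ?subrr.
have q_n s : dot (q s) n = 0 by rewrite edge_tangent.
have u_n : dot u n = 0 by rewrite edge_tangent // mxE eqxx.
have n1 := normal1 i.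
pose g s := dot (cross (x - p s) (q s)) n.
have uqE s : dot (cross u (q s)) n = face_orient i (upd o l s).
  by rewrite /face_orient -/k -/l -/m edge_upd_same.
(* The sides s = 0 and s = 1 of the quadrilateral lie in neighbouring faces. *)
have endpoint (b : bool) : g b%:R * dot u (normal E (facet l b)) =
    dot (x - p b%:R) (normal E (facet l b)) * face_orient i (upd o l b%:R).
  rewrite /g -uqE; apply: dot_cross_switch => //.
  by rewrite edge_tangent ?axis_facet ?side_facet // upd_same.
have away (b : bool) : dot (x - p b%:R) (normal E (facet l b)) <= 0.
  rewrite dotBl subr_le0 [X in _ <= X]tri_on ?axis_facet ?side_facet ?upd_same //.
  by apply: xj; rewrite axis_facet.
have u0 : dot u (normal E (facet l false)) < 0.
  by have := @edge_inward (facet l false) o; rewrite axis_facet side_facet; apply.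
have u1 : 0 < dot u (normal E (facet l true)).
  by have := @edge_outward (facet l true) o; rewrite axis_facet side_facet; apply.
(* The slopes of u against the two sides have opposite signs, whereas the
   orientation is the same at both ends. *)
have sgn : g 0 * g 1 <= 0.
  have k01 : 0 < face_orient i (upd o l 0) * face_orient i (upd o l 1).
    by apply: face_orient_same => //; apply: y_cube; rewrite cube01.
  have := endpoint false; have := endpoint true.
  have := away false; have := away true.
  rewrite /= => a1 a0 e1 e0.
  have : 0 <= (g 0 * g 1) *
      (dot u (normal E (facet l false)) * dot u (normal E (facet l true))).
    rewrite mulrACA e0 e1 mulrACA mulr_ge0 ?(ltW k01) //.
    by rewrite mulr_le0.
  by rewrite nmulr_lge0 // nmulr_rlt0.
have [s s01 gs] : exists2 s, 0 <= s <= 1 & g s = 0.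
  pose a1 := dot (cross (x - p 0) (q 1)) n.
  pose b0 := dot (cross u (q 0)) n; pose b1 := dot (cross u (q 1)) n.
  have gE s : g s = (1 - s) * g 0 + s * a1 - s * ((1 - s) * b0 + s * b1).
    have shift w : dot (cross (x - p s) w) n =
        dot (cross (x - p 0) w) n - s * dot (cross u w) n.
      by rewrite (pE s) opprD addrA; exact: dot_cross_shift.
    have -> : g s = (1 - s) * dot (cross (x - p s) (q 0)) n
                    + s * dot (cross (x - p s) (q 1)) n.
      by rewrite /g {1}(qE s); exact: dot_cross_mixr.
    rewrite !shift -/(g 0) -/a1 -/b0 -/b1.
    by move: (g 0) a1 b0 b1 => a0 a1' b0' b1'; ring.
  move: sgn gE; move: (g) a1 b0 b1 => h a1 b0 b1 sgn hE.
  have [|s s01 e] := @quadratic_root (h 0) (a1 - h 0 - b0) (b0 - b1).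
    by rewrite (_ : _ + _ + _ = h 1) // (hE 1); ring.
  by exists s; rewrite // hE -[RHS]e; ring.
have cy := y_cube s s01.
have q0 : dot (q s) (normal E (facet m false)) < 0.
  by have := @edge_inward (facet m false) (upd o l s); rewrite axis_facet side_facet; apply.
have q1 : 0 < dot (q s) (normal E (facet m true)).
  by have := @edge_outward (facet m true) (upd o l s); rewrite axis_facet side_facet; apply.
have qn0 : q s != 0 by apply: contraTneq q1 => ->; rewrite dot0l ltxx.
pose t := dot (x - p s) (q s) / dot (q s) (q s).
have xE : x = p s + t *: q s.
  by rewrite -(perp_collinear n1 (y_n s) (q_n s) qn0 gs) addrC subrK.
have triE c : tri_map E (upd (upd o l s) m c) = p s + c *: q s.
  by rewrite tri_upd y_m.
have bound (b : bool) : dot x (normal E (facet m b)) <=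
    dot (tri_map E (upd (upd o l s) m b%:R)) (normal E (facet m b)).
  rewrite [X in _ <= X]tri_on ?axis_facet ?side_facet ?upd_same //.
  by apply: xj; rewrite axis_facet.
exists (upd (upd o l s) m t); last by rewrite triE.
apply: upd_cube => //; apply/andP; split.
  by have := bound false; rewrite triE xE !dotDl !dotZl /= lerD2l mul0r nmulr_lle0.
have := bound true; rewrite triE {1}xE !dotDl !dotZl /= lerD2l mul1r.
by rewrite -[X in _ <= X]mul1r ler_pM2r.
Qed.

End Faces.

(** * Fluxes of the reference supplements *)

Section ReferenceSupplements.
Variables (R : realType) (E : hexahedron R).
Hypothesis jac_gt0 : forall x : 'rV[R]_3, ref_cube x -> 0 < jac E x.
Implicit Types (x y : 'rV[R]_3) (k l m : 'I_3) (i j : 'I_6) (s t : R).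

Lemma sum_ord2 (V : nmodType) (f : 'I_2 -> V) : \sum_p f p = f 0 + f 1.
Proof.
rewrite 2!big_ord_recl big_ord0 addr0.
by congr (f _ + f _); apply: val_inj.
Qed.

Lemma face_jac_sum (a : 'M[R]_2) s t :
  \sum_(p < 2) \sum_(q < 2 | (1 <= p + q)%N)
    a p q * (s ^+ p * t ^+ q - 1 / (p.+1%:R * q.+1%:R)) =
  a 0 1 * (t - 1 / 2) + a 1 0 * (s - 1 / 2) + a 1 1 * (s * t - 1 / 4).
Proof.
rewrite sum_ord2 !big_mkcond !sum_ord2 /= !expr0 !expr1 !mul1r !mulr1.
by rewrite -natrM add0r addrA.
Qed.

(** The point of the reference face with the parameters used by [face_jac]. *)
Definition face_point i s t : 'rV[R]_3 := xcol 0 (axis i) (row3 1 s t).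

Lemma face_point_upd i s t : face_point i s t =
  upd (upd (face_point i 0 0) (tperm 0 (axis i) 1) s) (tperm 0 (axis i) 2) t.
Proof.
apply/rowP => l; rewrite !mxE -(inj_eq (@perm_inj _ (tperm 0 (axis i))) l (tperm _ _ 1)).
rewrite -(inj_eq (@perm_inj _ (tperm 0 (axis i))) l (tperm _ _ 2)) !tpermK.
by move: (tperm _ _ l); apply: ord3_cases.
Qed.

Lemma face_point_axis i s t : face_point i s t 0 (axis i) = 1.
Proof. by rewrite !mxE tpermR. Qed.

Lemma face_point_cube i s t : 0 <= s <= 1 -> 0 <= t <= 1 ->
  ref_cube (face_point i s t).
Proof.
move=> s01 t01 l; rewrite !mxE; move: (tperm _ _ l).
by apply: ord3_cases; rewrite /= ?cube01.
Qed.

(** The transposition of axes 0 and k preserves the unordered pair of the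
    other two axes, and the norm of a cross product does not see its order. *)
Lemma enorm_cross_tperm (f : 'I_3 -> 'rV[R]_3) k :
  enorm (cross (f (tperm 0 k 1)) (f (tperm 0 k 2))) =
  enorm (cross (f (k + 1)) (f (k + 2))).
Proof.
move: k; apply: ord3_cases.
- by rewrite !tperm1 !perm1 !add0r.
- by rewrite tpermR tpermD // !ord3_addE cross_anti enormN.
- by rewrite tpermR tpermD // !ord3_addE cross_anti enormN.
Qed.

Lemma face_jac_orient i s t : side i -> 0 <= s <= 1 -> 0 <= t <= 1 ->
  face_jac E i s t = face_orient E i (face_point i s t).
Proof.
move=> si s01 t01; rewrite /face_jac -/(face_point i s t) !partialE.
have cx := face_point_cube i s01 t01.
have xi : face_point i s t 0 (axis i) = (side i)%:R by rewrite face_point_axis si.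
rewrite (enorm_cross_tperm (fun l => edge E l _)).
by rewrite face_cross // enormZ_unit ?normal1 // gtr0_norm // face_orient_gt0.
Qed.

(** The density is affine in each of the two parameters, so it is determined
    by its values at the four corners, and these give the coefficients. *)
Lemma face_jac_coefP i s t : side i -> 0 <= s <= 1 -> 0 <= t <= 1 ->
  let a := face_jac_coef E i in
  face_orient E i (face_point i s t) =
  a 0 0 + (a 0 1 * (t - 1 / 2) + a 1 0 * (s - 1 / 2) + a 1 1 * (s * t - 1 / 4)).
Proof.
move=> si s01 t01 a; rewrite -face_jac_sum -face_jac_orient //.
have : exists a : 'M[R]_2, forall s t, 0 <= s <= 1 -> 0 <= t <= 1 ->
    face_jac E i s t = a 0 0 + \sum_(p < 2) \sum_(q < 2 | (1 <= p + q)%N)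
      a p q * (s ^+ p * t ^+ q - 1 / (p.+1%:R * q.+1%:R)).
  pose K s t := face_orient E i (face_point i s t).
  pose k00 := K 0 0; pose k10 := K 1 0; pose k01 := K 0 1; pose k11 := K 1 1.
  (* The constant term absorbs the mean values 1/2, 1/2, 1/4 that the basis
     functions subtract. *)
  pose c10 := k10 - k00; pose c01 := k01 - k00; pose c11 := k11 - k10 - k01 + k00.
  exists (\matrix_(p, q) if p == 0 then
     (if q == 0 then k00 + c10 / 2 + c01 / 2 + c11 / 4 else c01)
     else (if q == 0 then c10 else c11)).
  move=> {s01 t01}s {}t s01 t01; rewrite face_jac_orient // face_jac_sum !mxE /=.
  have lin1 c x : face_orient E i (upd x (tperm 0 (axis i) 1) c) =
      (1 - c) * face_orient E i (upd x (tperm 0 (axis i) 1) 0) +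
      c * face_orient E i (upd x (tperm 0 (axis i) 1) 1).
    apply: face_orient_upd; rewrite -[X in _ != X](tpermL 0 (axis i)).
    by rewrite (inj_eq perm_inj).
  have lin2 c x : face_orient E i (upd x (tperm 0 (axis i) 2) c) =
      (1 - c) * face_orient E i (upd x (tperm 0 (axis i) 2) 0) +
      c * face_orient E i (upd x (tperm 0 (axis i) 2) 1).
    apply: face_orient_upd; rewrite -[X in _ != X](tpermL 0 (axis i)).
    by rewrite (inj_eq perm_inj).
  have K2 s' c : K s' c = (1 - c) * K s' 0 + c * K s' 1.
    rewrite /K (face_point_upd i s' c) (face_point_upd i s' 0) (face_point_upd i s' 1).
    exact: lin2.
  have K1 c t' : K c t' = (1 - c) * K 0 t' + c * K 1 t'.
    rewrite /K (face_point_upd i c t') (face_point_upd i 0 t') (face_point_upd i 1 t').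
    have n12 : tperm 0 (axis i) 1 != tperm 0 (axis i) 2 by rewrite (inj_eq perm_inj).
    by rewrite !(updC _ _ t' n12); exact: lin1.
  rewrite -/(K s t) K2 (K1 s 0) (K1 s 1) -/k00 -/k10 -/k01 -/k11 /c11 /c10 /c01.
  by clear c10 c01 c11; move: k00 k10 k01 k11 => *; field.
by move=> /(@getPex _ _); apply.
Qed.

Lemma ref_sigmaE i x l : ref_sigma E i x 0 l =
  \sum_(p < 2) \sum_(q < 2) face_jac_coef E i p q *
    psi p q (xcol 0 (axis i) x) 0 (tperm 0 (axis i) l).
Proof.
rewrite /ref_sigma mxE !summxE; apply: eq_bigr => p _.
by rewrite summxE; apply: eq_bigr => q _; rewrite mxE.
Qed.

Lemma ref_sigma_own i x : side i -> ref_cube x -> x 0 (axis i) = 1 ->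
  ref_sigma E i x 0 (axis i) = face_orient E i x.
Proof.
move=> si cx xi; rewrite ref_sigmaE tpermR !sum_ord2.
set y := xcol 0 (axis i) x.
have y0 : y 0 0 = 1 by rewrite !mxE tpermL.
have xE : x = face_point i (y 0 1) (y 0 2).
  apply/rowP => l; rewrite !mxE -[in LHS](tpermK 0 (axis i) l).
  move: (tperm 0 (axis i) l); apply: ord3_cases => //=.
  by rewrite tpermL.
have cy : ref_cube y by move=> l; rewrite mxE.
clearbody y; rewrite [in RHS]xE face_jac_coefP //.
rewrite /psi /= !mxE /= y0 !expr0 !expr1.
have -> : (1 %% 2).+1%:R = 2 :> R by [].
by move: (face_jac_coef E i) (y 0 1) (y 0 2) => a s t; field.
Qed.

Lemma psi_comp0 p q x : x 0 0 = 0 -> psi p q x 0 0 = 0.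
Proof. by rewrite /psi => x0; case: ifP => _; rewrite mxE /= x0 ?mul0r ?subr0. Qed.

Lemma psi_comp1 (p : 'I_2) q x (b : bool) : x 0 1 = b%:R -> psi p q x 0 1 = 0.
Proof.
rewrite /psi => x1; case: ifP => _; rewrite mxE /= ?x1 //; clear x1.
by case: p => [[|[|//]] ?]; case: b; rewrite /= ?expr0 ?expr1 ?subrr ?mulr0 ?mul0r.
Qed.

Lemma psi_comp2 p (q : 'I_2) x (b : bool) : x 0 2 = b%:R -> psi p q x 0 2 = 0.
Proof.
rewrite /psi => x2; case: ifP => _; rewrite mxE /= ?x2 //; clear x2.
by case: q => [[|[|//]] ?]; case: b; rewrite /= ?expr0 ?expr1 ?subrr ?mulr0 ?mul0r.
Qed.

(** A face adjacent to face i is touched through the second or third component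
    of [psi], which contain the factor x (1 - x^p), zero at both ends (also for
    p = 0); the face opposite to i is touched through the first one, which
    contains the factor x_1. *)
Lemma ref_sigma_other i j x : side i -> i != j -> x 0 (axis j) = (side j)%:R ->
  ref_sigma E i x 0 (axis j) = 0.
Proof.
move=> si ij xj; rewrite ref_sigmaE; apply: big1 => p _; apply: big1 => q _.
have {}xj : xcol 0 (axis i) x 0 (tperm 0 (axis i) (axis j)) = (side j)%:R.
  by rewrite !mxE tpermK.
apply/eqP; rewrite mulf_eq0; apply/orP; right; apply/eqP.
(* An odd face with the same axis as the odd face i is face i. *)
have t0 : tperm 0 (axis i) (axis j) = 0 -> ~~ side j.
  move=> e; apply: contraNN ij => sj.
  have : axis j = axis i by rewrite -(tpermK 0 (axis i) (axis j)) e tpermL.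
  by move=> a; rewrite -(facet_id i) -(facet_id j) a si sj.
move: (tperm 0 (axis i) (axis j)) t0 xj; apply: ord3_cases => t0 xj.
- by rewrite psi_comp0 // xj (negPf (t0 erefl)).
- exact: psi_comp1 xj.
- exact: psi_comp2 xj.
Qed.

Lemma tri_inv i (x : body E) : face E i (set_val x) ->
  let xh := tri_map_inv E (set_val x) in
  [/\ ref_cube xh, tri_map E xh = set_val x & xh 0 (axis i) = (side i)%:R].
Proof.
move=> fx xh; have [bx xi] := (faceP E i _).1 fx.
have [yh cy yx] := face_onto jac_gt0 xi (fun j _ => body_le j bx).
have im : (tri_map E @` @ref_cube R) (set_val x) by exists yh.
have xhx : tri_map E xh = set_val x by apply: pinvK; rewrite inE.
have cxh : ref_cube xh.
  apply: (@surjpinv_image_sub _ _ (fun=> 0) _ [set set_val x] (tri_map E)).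
    by move=> _ /= ->.
  by exists (set_val x).
by split=> //; apply: (@tri_face _ E) => //; rewrite xhx.
Qed.

(** The normal part of the derivative in the direction of the axis occurs in
    the flux and in the Jacobian, and cancels. *)
Lemma flux_piola i vh (x : body E) : face E i (set_val x) ->
  let xh := tri_map_inv E (set_val x) in
  dot (piola vh x) (normal E i) = vh xh 0 (axis i) / face_orient E i xh.
Proof.
move=> fx xh; have [cx _ xi] := tri_inv fx; rewrite -/xh in cx xi.
have J0 : jac E xh != 0 by rewrite gt_eqF // jac_gt0.
rewrite /piola -/xh dotZl mulmx_jacobian dot_suml (bigD1 (axis i)) //=.
rewrite big1 ?addr0 => [|l li]; last by rewrite dotZl edge_tangent ?mulr0.
rewrite dotZl; move: J0; rewrite (jac_face E xi) mulf_eq0 negb_or => /andP[e0 k0].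
by field; rewrite e0 k0.
Qed.

Lemma flux_sigma i j (l : 'I_6) (x : body E) :
  side i -> side j -> face E l (set_val x) ->
  dot (sigma i j x) (normal E l) =
  (i == l)%:R / area (face E i) - (j == l)%:R / area (face E j).
Proof.
move=> si sj fx; rewrite /sigma flux_piola //.
have [cx _ xl] := tri_inv fx; move: (tri_map_inv _ _) cx xl => xh cx xl.
have k0 : face_orient E l xh != 0.
  by have := jac_gt0 cx; rewrite (jac_face E xl); apply: contraTneq => ->; rewrite mulr0 ltxx.
have val (m : 'I_6) : side m -> ref_sigma E m xh 0 (axis l) = (m == l)%:R * face_orient E l xh.
  move=> sm; have [ml|ml] := eqVneq m l; last by rewrite ref_sigma_other // mul0r.
  by rewrite mul1r -ml ref_sigma_own // ml xl -ml sm.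
rewrite addvE oppvE !scalevE !val //; move: (face_orient E l xh) k0 => k k0.
by move: (_^-1) (_^-1) => a b; field.
Qed.

End ReferenceSupplements.

(** * Positive area of the faces *)

(** A bounded polygon with an interior point contains a small square and is
    contained in a large one. *)
Lemma polygon_measure_gt0 (R : realType) (I : finType) (D : pred I)
    (a b c : I -> R) (s0 t0 M : R) :
  let S := [set st : R * R | forall j, D j -> a j + st.1 * b j + st.2 * c j <= 0] in
  (forall j, D j -> a j + s0 * b j + t0 * c j < 0) ->
  (forall st, S st -> `|st.1| <= M /\ `|st.2| <= M) ->
  0 < fine ((@lebesgue_measure R \x @lebesgue_measure R)%E S).
Proof.
move=> S strict bounded; set mu := (_ \x _)%E.
have measS : measurable S.
  have -> : S = \bigcap_(j in [set j | D j])
      ((fun st : R * R => a j + st.1 * b j + st.2 * c j) @^-1` `]-oo, 0]%classic).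
    apply/seteqP; split => [st Sst j /= Dj|st Sst j Dj].
      by rewrite /= in_itv /= Sst.
    by have := Sst j Dj; rewrite /= in_itv.
  apply: fin_bigcap_measurable => [|j _]; first exact: finite_finset.
  have mf : measurable_fun setT (fun st : R * R => a j + st.1 * b j + st.2 * c j).
    apply: measurable_funD; first apply: measurable_funD; first exact: measurable_cst.
      by apply: measurable_funM; [exact: measurable_fst | exact: measurable_cst].
    by apply: measurable_funM; [exact: measurable_snd | exact: measurable_cst].
  by rewrite -[X in measurable X]setTI; exact: mf.
have [e e0 he] : exists2 e : R, 0 < e & forall j, D j ->
    a j + s0 * b j + t0 * c j + e * (`|b j| + `|c j|) <= 0.
  pose N j := `|b j| + `|c j|; pose g j := - (a j + s0 * b j + t0 * c j).
  have N1 j : 0 < N j + 1 by rewrite ltr_wpDl ?addr_ge0.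
  (* Moving by e in both coordinates changes form j by at most e (|b j| + |c j|). *)
  exists (\big[Num.min/1]_(j | D j) (g j / (N j + 1))).
    apply/bigmin_gtP; split=> // j Dj.
    by rewrite divr_gt0 // oppr_gt0 strict.
  move=> j Dj; set e := \big[_/_]_(_ | _) _.
  have : e <= g j / (N j + 1) by exact: bigmin_le_cond.
  have e0 : 0 <= e.
    apply/ltW/bigmin_gtP; split=> // k Dk.
    by rewrite divr_gt0 // oppr_gt0 strict.
  by rewrite ler_pdivlMr // -/(N j) /g mulrDr mulr1; lra.
have box_meas (x y r : R) : 0 < r ->
    mu ([set` `[x - r, x + r]] `*` [set` `[y - r, y + r]]) = ((r *+ 2) ^+ 2)%:E.
  move=> r0; have len z : lebesgue_measure ([set` `[z - r, z + r]] : set R) = (r *+ 2)%:E.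
    rewrite lebesgue_measure_itv /= lte_fin ifT; last by lra.
    by rewrite -EFinB; congr EFin; ring.
  rewrite /mu product_measure1E // expr2 EFinM.
  by congr (_ * _)%E; exact: len.
have M0 : 0 <= M.
  have [|+ _] := bounded (s0, t0); first by move=> j Dj; apply/ltW/strict.
  by apply: le_trans.
have mbox (x y r : R) : measurable ([set` `[x - r, x + r]] `*` [set` `[y - r, y + r]]).
  exact: measurableX.
have fin : (mu S < +oo)%E.
  (* M may be 0, and the measure of the square is computed for a positive
     half side. *)
  have M1 : 0 < M + 1 by rewrite ltr_wpDl.
  apply: (@le_lt_trans _ _ (mu ([set` `[0 - (M + 1), 0 + (M + 1)]] `*`
                                [set` `[0 - (M + 1), 0 + (M + 1)]]))).
    apply: le_measure; [exact: (mem_set measS) | exact: (mem_set (mbox _ _ _)) |].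
    move=> st /bounded [+ +]; rewrite !ler_norml.
    by move=> /andP[? ?] /andP[? ?]; split; rewrite /= in_itv /=; lra.
  by rewrite box_meas // ltry.
have pos : (0 < mu S)%E.
  apply: (@lt_le_trans _ _ (mu ([set` `[s0 - e, s0 + e]] `*` [set` `[t0 - e, t0 + e]]))).
    by rewrite box_meas // lte_fin exprn_gt0 // mulrn_wgt0.
  apply: le_measure; [exact: (mem_set (mbox _ _ _)) | exact: (mem_set measS) |].
  move=> [s t] [/=]; rewrite !in_itv /= -!ler_distlC => se te j Dj /=.
  apply: le_trans (he j Dj); rewrite mulrDr.
  have cmp (z z0 d : R) : `|z0 - z| <= e -> z * d <= z0 * d + e * `|d|.
    move=> ze; rewrite -lerBlDl -mulrBl; apply: le_trans (ler_norm _) _.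
    by rewrite normrM distrC ler_wpM2r.
  by have := cmp _ _ (b j) se; have := cmp _ _ (c j) te; lra.
by rewrite fine_gt0 // pos.
Qed.

Section FaceArea.
Variables (R : realType) (E : hexahedron R).
Hypothesis jac_gt0 : forall x : 'rV[R]_3, ref_cube x -> 0 < jac E x.
Implicit Types (x y : 'rV[R]_3) (k l m : 'I_3) (i j : 'I_6) (s t : R).

(** Points satisfying the inequalities lie in the face because [face_onto]
    exhibits them as values of the trilinear map. *)
Lemma face_halfspaces i x : face E i x <-> dot x (normal E i) = offset E i /\
  forall j, axis j != axis i -> dot x (normal E j) <= offset E j.
Proof.
split=> [/faceP[bx xi]|[xi xj]].
  by split=> // j _; exact: body_le.
apply/faceP; split=> //; have [xh cx <-] := face_onto jac_gt0 xi xj.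
exact: tri_body.
Qed.

Definition face_corner i : 'rV[R]_3 :=
  \row_k (if k == axis i then (side i)%:R else 0).

Lemma face_corner_cube i : ref_cube (face_corner i).
Proof. by move=> j; rewrite mxE; case: (j == axis i) (side i) => [] []; rewrite ?cube01. Qed.

Lemma face_corner_axis i : face_corner i 0 (axis i) = (side i)%:R.
Proof. by rewrite mxE eqxx. Qed.

Lemma tri_in_face i x : ref_cube x -> x 0 (axis i) = (side i)%:R ->
  face E i (tri_map E x).
Proof. by move=> cx xi; apply/faceP; split; [exact: tri_body | exact: tri_on]. Qed.

Lemma face_orient_neq0 i x : ref_cube x -> x 0 (axis i) = (side i)%:R ->
  face_orient E i x != 0.
Proof.
move=> cx xi; have := jac_gt0 cx; rewrite (jac_face E xi).
by apply: contraTneq => ->; rewrite mulr0 ltxx.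
Qed.

(** A normalized edge and its rotation in the plane of the face. *)
Lemma planar_frame_exists i : exists e, planar_frame (face E i) e.
Proof.
set n := normal E i; have n1 : dot n n = 1 := normal1 E i.
have ci := face_corner_cube i; have ai := face_corner_axis i.
set u0 := edge E (axis i + 1) (face_corner i).
have u0n : dot u0 n = 0 by rewrite edge_tangent ?neq_succ1.
have u00 : dot u0 u0 != 0.
  apply: contra_neq (face_orient_neq0 ci ai) => /dot_eq0 u00.
  by rewrite /face_orient -/u0 u00 -(scale0r 0) crossZl dotZl mul0r.
pose u := (Num.sqrt (dot u0 u0))^-1 *: u0.
have u1 : dot u u = 1.
  rewrite /u dotZl dotC dotZl mulrA -invfM -expr2 sqr_sqrtr ?dot_ge0 //.
  by rewrite mulVf.
have un : dot u n = 0 by rewrite /u dotZl u0n mulr0.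
pose w := cross n u.
have w1 : dot w w = 1.
  have -> : dot w w = dot n n * dot u u - dot u n ^+ 2.
    by rewrite /w !coordE; ring.
  by rewrite n1 u1 un expr0n subr0 mulr1.
have wn : dot w n = 0 by rewrite /w !coordE; ring.
have wu : dot u w = 0 by rewrite /w !coordE; ring.
have w0 : w != 0 by apply: contra_eq_neq w1 => ->; rewrite dot0l eq_sym oner_eq0.
exists (tri_map E (face_corner i), u, w); split=> // x /faceP[_ xn].
set p := tri_map E _.
have [y yE] : exists y, y = x - p by exists (x - p).
have yn : dot y n = 0 by rewrite yE dotBl xn /p tri_on // subrr.
pose z := y - dot y u *: u.
have zn : dot z n = 0 by rewrite /z dotBl dotZl yn un mulr0 subrr.
have zu : dot z u = 0 by rewrite /z dotBl dotZl u1 mulr1 subrr.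
have zw : dot (cross z w) n = 0.
  have -> : dot (cross z w) n = dot z u * dot n n - dot u n * dot z n.
    by move: z zn zu => z _ _; rewrite /w !coordE; ring.
  by rewrite zu zn mul0r mulr0 subrr.
exists (dot y u, dot z w / dot w w) => //=.
rewrite -(perp_collinear n1 zn wn w0 zw) /z -addrA [X in p + X]addrC subrK yE.
by rewrite addrC subrK.
Qed.

(** A coordinate plane that contains the face is the supporting plane, since
    the face contains two independent edges. *)
Lemma plane_normal i o u w : planar_frame (face E i) (o, u, w) ->
  [/\ dot u (normal E i) = 0, dot w (normal E i) = 0 &
      dot o (normal E i) = offset E i].
Proof.
case=> _ _ _ plane; set n := normal E i.
pose c := face_corner i; have cc : ref_cube c := face_corner_cube i.
have ai : c 0 (axis i) = (side i)%:R := face_corner_axis i.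
have c_l l : l != axis i -> c 0 l = 0 by rewrite mxE => /negPf ->.
set l := axis i + 1; set m := axis i + 2.
have li : l != axis i := neq_succ1 _; have mi : m != axis i := neq_succ2 _.
have pt k : k != axis i -> exists a b,
    tri_map E c + edge E k c = o + a *: u + b *: w.
  move=> ki; have [|[a b] _ /= ab] := plane (tri_map E (upd c k 1)).
    apply: tri_in_face; first by apply: upd_cube; rewrite ?cube01.
    by rewrite upd_other // eq_sym.
  exists a, b; rewrite ab tri_upd scale1r -[in LHS](upd_id c k).
  by rewrite c_l // edge_upd_same.
have [[a0 b0] _ /= p0] := plane _ (tri_in_face cc ai).
have [a1 [b1 p1]] := pt l li; have [a2 [b2 p2]] := pt m mi.
have el : edge E l c = (a1 - a0) *: u + (b1 - b0) *: w.
  apply: (addrI (tri_map E c)); rewrite p1 -p0.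
  by apply: rV3P; rewrite !coordE; ring.
have em : edge E m c = (a2 - a0) *: u + (b2 - b0) *: w.
  apply: (addrI (tri_map E c)); rewrite p2 -p0.
  by apply: rV3P; rewrite !coordE; ring.
have eln : dot (edge E l c) n = 0 by rewrite edge_tangent.
have emn : dot (edge E m c) n = 0 by rewrite edge_tangent.
pose d := (a1 - a0) * (b2 - b0) - (b1 - b0) * (a2 - a0).
have d0 : d != 0.
  apply: contra_neq (face_orient_neq0 cc ai) => d0.
  rewrite /face_orient -/l -/m el em.
  rewrite (_ : dot _ _ = d * dot (cross u w) n); first by rewrite d0 mul0r.
  by rewrite /d !coordE; ring.
move: eln emn; rewrite el em !dotDl !dotZl => eln emn.
have un : dot u n = 0.
  apply: (mulfI d0); rewrite mulr0.
  have -> : d * dot u n = (b2 - b0) * ((a1 - a0) * dot u n + (b1 - b0) * dot w n)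
     - (b1 - b0) * ((a2 - a0) * dot u n + (b2 - b0) * dot w n) by rewrite /d; ring.
  by rewrite eln emn !mulr0 subrr.
have wn : dot w n = 0.
  apply: (mulfI d0); rewrite mulr0.
  have -> : d * dot w n = (a1 - a0) * ((a2 - a0) * dot u n + (b2 - b0) * dot w n)
     - (a2 - a0) * ((a1 - a0) * dot u n + (b1 - b0) * dot w n) by rewrite /d; ring.
  by rewrite eln emn !mulr0 subrr.
split=> //; have := @tri_on _ E i c ai; rewrite -p0 !dotDl !dotZl -/n un wn.
by rewrite !mulr0 !addr0.
Qed.

Lemma body_bounded v : exists M, forall x, body E x -> `|dot x v| <= M.
Proof.
exists (\sum_b `|dot (vertex E b) v|) => x; rewrite body_hull => -[t [t0 t1] <-].
rewrite dot_suml; apply: le_trans (ler_norm_sum _ _ _) _.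
apply: ler_sum => b _; rewrite dotZl normrM ger0_norm // ler_piMl //.
by rewrite -t1 (bigD1 b) //= lerDl sumr_ge0.
Qed.

(** The area is read in an arbitrarily chosen frame; in its coordinates the
    face is the set where four affine forms are nonpositive, and these are negative
    at the image of the centre of the reference face. *)
Lemma area_gt0 i : 0 < area (face E i).
Proof.
rewrite /area; have := getPex (planar_frame_exists i).
case: (get _) => [[ o u] w] frame; have [un wn o_n] := plane_normal frame.
case: frame => u1 w1 uw plane.
pose a j := dot o (normal E j) - offset E j.
pose b j := dot u (normal E j); pose c j := dot w (normal E j).
have affine s t j :
    dot (o + s *: u + t *: w) (normal E j) - offset E j = a j + s * b j + t * c j.
  by rewrite /a /b /c !dotDl !dotZl; ring.
have -> : [set st : R * R | face E i (o + st.1 *: u + st.2 *: w)] =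
    [set st : R * R | forall j, axis j != axis i -> a j + st.1 * b j + st.2 * c j <= 0].
  apply/seteqP; split=> [[s t] /= /face_halfspaces[_ h] j ji|[s t] /= h].
    by rewrite -affine subr_le0 h.
  apply/face_halfspaces; split=> [|j ji]; first by rewrite !dotDl !dotZl un wn o_n; ring.
  by rewrite -subr_le0 affine h.
have [Mu bu] := body_bounded u; have [Mw bw] := body_bounded w.
pose x0 : 'rV[R]_3 := \row_k (if k == axis i then (side i)%:R else 2^-1).
have cx0 : ref_cube x0.
  move=> k; rewrite mxE; case: eqP => _; first by case: (side i); rewrite cube01.
  by apply/andP; split; lra.
have [|[s0 t0] _ /= p0] := plane (tri_map E x0).
  by apply: tri_in_face => //; rewrite mxE eqxx.
apply: (@polygon_measure_gt0 _ _ _ a b c s0 t0 (Mu + Mw + `|dot o u| + `|dot o w|)).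
  move=> j ji; rewrite -affine p0 subr_lt0; apply: tri_lt => //.
  by rewrite mxE (negPf ji); case: (side j); apply/eqP => /= e; lra.
move=> [s t] /= h.
have /faceP[bx _] : face E i (o + s *: u + t *: w).
  apply/face_halfspaces; split=> [|j ji]; first by rewrite !dotDl !dotZl un wn o_n; ring.
  by rewrite -subr_le0 affine h.
have := bu _ bx; have := bw _ bx; rewrite !dotDl !dotZl u1 w1 uw (dotC w u) uw.
rewrite !mulr0 !mulr1 !addr0 => tw su.
have shift v r : `|r| <= `|dot o v + r| + `|dot o v|.
  by rewrite -{1}(addrK (dot o v) r) (addrC r) ler_normB.
have := shift u s; have := shift w t.
have := normr_ge0 (dot o u); have := normr_ge0 (dot o w).
have := le_trans (normr_ge0 _) tw; have := le_trans (normr_ge0 _) su.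
by move=> *; split; lra.
Qed.

End FaceArea.

(** * Fluxes of the lowest order space *)

Lemma ord6_cases (P : 'I_6 -> Prop) :
  P 0 -> P 1 -> P 2 -> P 3 -> P 4 -> P 5 -> forall i, P i.
Proof.
move=> P0 P1 P2 P3 P4 P5 [[|[|[|[|[|[|//]]]]]] lt_i6].
- by rewrite (_ : Ordinal lt_i6 = 0) //; apply: val_inj.
- by rewrite (_ : Ordinal lt_i6 = 1) //; apply: val_inj.
- by rewrite (_ : Ordinal lt_i6 = 2) //; apply: val_inj.
- by rewrite (_ : Ordinal lt_i6 = 3) //; apply: val_inj.
- by rewrite (_ : Ordinal lt_i6 = 4) //; apply: val_inj.
- by rewrite (_ : Ordinal lt_i6 = 5) //; apply: val_inj.
Qed.

Lemma facet_even : (facet 0 false = 0) * (facet 1 false = 2) * (facet 2 false = 4).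
Proof. by do !split; apply: val_inj; rewrite /facet /= inordK. Qed.

Section SupplementFluxes.
Variables (R : realType) (A h : 'I_6 -> R).
Hypothesis A_gt0 : forall i, 0 < A i.
Implicit Types (i j m n : 'I_6) (a p q : R).

(** The flux on face i of sigma^{m,n}, with A the areas of the faces. *)
Definition supp_flux m n i : R := (m == i)%:R / A m - (n == i)%:R / A n.

Lemma supp_fluxE :
  ((supp_flux 1 3 0 = 0) * (supp_flux 1 3 1 = (A 1)^-1) *
   (supp_flux 1 3 2 = 0) * (supp_flux 1 3 3 = - (A 3)^-1) *
   (supp_flux 1 3 4 = 0) * (supp_flux 1 3 5 = 0)) *
  ((supp_flux 3 5 0 = 0) * (supp_flux 3 5 1 = 0) * (supp_flux 3 5 2 = 0) *
   (supp_flux 3 5 3 = (A 3)^-1) * (supp_flux 3 5 4 = 0) *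
   (supp_flux 3 5 5 = - (A 5)^-1)).
Proof. by do !split; rewrite /supp_flux /= ?mul0r ?mul1r ?subr0 ?sub0r ?oppr0. Qed.

Definition flux_scale : R := A 1 * h 1 + A 3 * h 3 + A 5 * h 5.

Hypothesis scale_gt0 : 0 < flux_scale.

(** Multiplying the three equations by the areas and adding them eliminates p
    and q and leaves a D = 0. *)
Lemma odd_fluxes_inj a p q :
  (forall i, side i -> a * h i + (p * supp_flux 1 3 i + q * supp_flux 3 5 i) = 0) ->
  [/\ a = 0, p = 0 & q = 0].
Proof.
move=> G; have := G 1 isT; have := G 3 isT; have := G 5 isT.
have A1 := gt_eqF (A_gt0 1); have A3 := gt_eqF (A_gt0 3).
have A5 := gt_eqF (A_gt0 5).
rewrite !supp_fluxE => e5 e3 e1.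
have aD : a * flux_scale = 0.
  have : A 1 * (a * h 1 + (p * (A 1)^-1 + q * 0)) +
    A 3 * (a * h 3 + (p * - (A 3)^-1 + q * (A 3)^-1)) +
    A 5 * (a * h 5 + (p * 0 + q * - (A 5)^-1)) = a * flux_scale.
    by rewrite /flux_scale; field; rewrite A1 A3 A5.
  by rewrite e1 e3 e5 !mulr0 !addr0.
have a0 : a = 0.
  by move/eqP: aD; rewrite mulf_eq0 (gt_eqF scale_gt0) orbF => /eqP.
move: e1 e5; rewrite a0 !(mul0r, mulr0, add0r, addr0) => e1 e5; split=> //.
  by move/eqP: e1; rewrite mulf_eq0 invr_eq0 A1 orbF => /eqP.
by move/eqP: e5; rewrite mulf_eq0 oppr_eq0 invr_eq0 A5 orbF => /eqP.
Qed.

Lemma odd_fluxes_dual j : (forall i, ~~ side i -> h i = 0) ->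
  let f a p q := a * (h j + p * supp_flux 1 3 j + q * supp_flux 3 5 j) in
  [/\ f (A 1 / flux_scale) (A 3 * h 3 + A 5 * h 5) (A 5 * h 5) = (1 == j)%:R,
      f (A 3 / flux_scale) (- (A 1 * h 1)) (A 5 * h 5) = (3 == j)%:R &
      f (A 5 / flux_scale) (- (A 1 * h 1)) (- (A 1 * h 1 + A 3 * h 3)) = (5 == j)%:R].
Proof.
move=> h0; have D0 : flux_scale != 0 by rewrite gt_eqF.
have A1 : A 1 != 0 by rewrite gt_eqF.
have A3 : A 3 != 0 by rewrite gt_eqF.
have A5 : A 5 != 0 by rewrite gt_eqF.
have [h00 h20 h40] : [/\ h 0 = 0, h 2 = 0 & h 4 = 0] by split; exact: h0.
by elim/ord6_cases: j; rewrite /= !supp_fluxE ?h00 ?h20 ?h40 /=; split;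
  rewrite ?mulr0 ?addr0 ?mulr0 //; move: D0; rewrite /flux_scale => D0;
  field; rewrite ?D0 ?A1 ?A3 ?A5.
Qed.

Lemma odd_facet_sum (g : 'I_6 -> R) j : side j ->
  g j - g 1 * (1 == j)%:R - g 3 * (3 == j)%:R - g 5 * (5 == j)%:R = 0.
Proof.
by elim/ord6_cases: j => //= _; rewrite !mulr0 !mulr1 ?subr0 ?subrr ?subr0.
Qed.

End SupplementFluxes.

Section Fluxes.
Variables (R : realType) (E : hexahedron R).
Hypothesis jac_gt0 : forall x : 'rV[R]_3, ref_cube x -> 0 < jac E x.
Implicit Types (u v : body E -> 'rV[R]_3) (i j : 'I_6) (a p q : R).

Lemma flux_unique i v (c c' : R) : flux_on i v c -> flux_on i v c' -> c = c'.
Proof.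
pose b : {ffun 'I_3 -> bool} := [ffun=> side i].
have fb : face E i (vertex E b) by apply/face_vertex; rewrite ffunE.
have bb : body E (vertex E b) := vertex_body E b.
pose x : body E := exist (fun y => y \in body E) (vertex E b) (mem_set bb).
by move=> /(_ x fb) <- /(_ x fb) <-.
Qed.

Lemma flux_get i v c : flux_on i v c -> get (flux_on i v) = c.
Proof. by move=> vc; apply: flux_unique (getI vc) vc. Qed.

Lemma fluxesE i v c : flux_on i v c -> fluxes v 0 i = c.
Proof. by move=> vc; rewrite mxE; exact: flux_get. Qed.

Lemma flux_lin i a u v c d : flux_on i u c -> flux_on i v d ->
  flux_on i (a *: u + v) (a * c + d).
Proof.
move=> uc vd x fx; have -> : (a *: u + v) x = a *: u x + v x by [].
by rewrite dotDl dotZl uc // vd.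
Qed.

Lemma flux_sum i (I : finType) (f : I -> body E -> 'rV[R]_3) (r d : I -> R) :
  (forall k, flux_on i (f k) (d k)) ->
  flux_on i (\sum_k r k *: f k) (\sum_k r k * d k).
Proof.
move=> fd x fx; rewrite fct_sumE dot_suml; apply: eq_bigr => k _.
by have -> : (r k *: f k) x = r k *: f k x by []; rewrite dotZl fd.
Qed.

Lemma flux_shifted i :
  flux_on i (@shifted_pos R E) (offset E i - dot (x024 E) (normal E i)).
Proof. by move=> x /faceP[_ xi]; rewrite /shifted_pos dotBl xi. Qed.

Lemma heightE i : height E i = offset E i - dot (x024 E) (normal E i).
Proof. exact/fluxesE/flux_shifted. Qed.

Lemma height_odd i : side i -> 0 < height E i.
Proof. by move=> si; rewrite heightE subr_gt0 vertex_lt // ffunE si. Qed.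

Lemma height_even i : ~~ side i -> height E i = 0.
Proof.
by move=> /negPf si; rewrite heightE vertex_on ?subrr // ffunE si.
Qed.

(** At x_024 the three derivatives of F are a basis, and the normals of the three
    faces meeting there are, up to nonzero factors, the dual basis. *)
Lemma even_normals_free z :
  (forall k, dot z (normal E (facet k false)) = 0) -> z = 0.
Proof.
move=> zn; have c0 : ref_cube (0 : 'rV[R]_3) by move=> k; rewrite mxE cube01.
pose M := 'J (tri_map E) (0 : 'rV[R]_3).
have uM : M \in unitmx by rewrite unitmxE unitfE gt_eqF // jac_gt0.
have [y zE] : exists y, z = y *m M by exists (z *m invmx M); rewrite mulmxKV.
suff y0 : y = 0 by rewrite zE y0 mul0mx.
apply/rowP => k; rewrite [RHS]mxE; have := zn k.
rewrite zE mulmx_jacobian dot_suml (bigD1 k) //= big1.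
  move/eqP; rewrite addr0 dotZl mulf_eq0 => /orP[/eqP //|].
  have := @edge_inward _ E (facet k false) 0; rewrite axis_facet side_facet.
  by move=> /(_ isT c0)/lt_eqF ->.
move=> l lk; rewrite dotZl edge_tangent ?mulr0 ?axis_facet //.
by rewrite mxE side_facet.
Qed.

Lemma even_normals_det k :
  dot (cross (normal E (facet (k + 1) false)) (normal E (facet (k + 2) false)))
      (normal E (facet k false)) != 0.
Proof.
pose N := \matrix_k normal E (facet k false).
have NE l : row l N = normal E (facet l false) by rewrite rowK.
rewrite dotC -!NE -det_cross -det_tr; apply/det0P => -[v v0 vN].
case/eqP: v0; apply: even_normals_free => l.
have /rowP/(_ l) := vN; rewrite !mxE => <-.
by rewrite /dot mxE; apply: eq_bigr => m _; rewrite !mxE.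
Qed.

Definition vec (c : 'rV[R]_3) a p q : body E -> 'rV[R]_3 :=
  (fun=> c) + (fun x => a *: set_val x) + (p *: sigma 1 3 + q *: sigma 3 5).

Lemma V0P v : V0 v <-> exists (c : 'rV[R]_3) a p q, v = vec c a p q.
Proof.
split=> [[_ [_ [_ [[c _ <-] [a _ <-] [[p q] _ <-] ->]]]]|[c [a [p [q ->]]]]].
  by exists c, a, p, q.
exists (fun=> c), (fun x => a *: set_val x), (p *: sigma 1 3 + q *: sigma 3 5).
by split=> //; [exists c | exists a | exists (p, q)].
Qed.

Lemma vec_lin (t : R) c a p q c' a' p' q' :
  t *: vec c a p q + vec c' a' p' q' =
  vec (t *: c + c') (t * a + a') (t * p + p') (t * q + q').
Proof.
apply/funext => x; apply/rowP => k.
have E1 : (t *: vec c a p q + vec c' a' p' q') x =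
  t *: (c + a *: set_val x + (p *: sigma 1 3 x + q *: sigma 3 5 x)) +
  (c' + a' *: set_val x + (p' *: sigma 1 3 x + q' *: sigma 3 5 x)) by [].
have E2 : vec (t *: c + c') (t * a + a') (t * p + p') (t * q + q') x =
  t *: c + c' + (t * a + a') *: set_val x +
  ((t * p + p') *: sigma 1 3 x + (t * q + q') *: sigma 3 5 x) by [].
rewrite E1 E2; move: (set_val x) (sigma 1 3 x) (sigma 3 5 x) => y z w.
by rewrite !(addvE, scalevE); ring.
Qed.

Lemma V0_lin a u v : V0 u -> V0 v -> V0 (a *: u + v).
Proof.
move=> /V0P[c [b [p [q ->]]]] /V0P[c' [b' [p' [q' ->]]]].
by apply/V0P; rewrite vec_lin; do 4!eexists.
Qed.

Let A i : R := area (face E i).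
Let s13 := supp_flux A 1 3.
Let s35 := supp_flux A 3 5.

Lemma flux_sigma13 i : flux_on i (@sigma R E 1 3) (s13 i).
Proof. by move=> x fx; exact: flux_sigma. Qed.

Lemma flux_sigma35 i : flux_on i (@sigma R E 3 5) (s35 i).
Proof. by move=> x fx; exact: flux_sigma. Qed.

Definition vec_flux (c : 'rV[R]_3) a p q i : R :=
  dot c (normal E i) + a * offset E i + (p * s13 i + q * s35 i).

Lemma flux_vec c a p q i : flux_on i (vec c a p q) (vec_flux c a p q i).
Proof.
move=> x fx; have -> : vec c a p q x =
  c + a *: set_val x + (p *: sigma 1 3 x + q *: sigma 3 5 x) by [].
have [_ xi] := (faceP E i _).1 fx.
move: (sigma 1 3 x) (sigma 3 5 x) (flux_sigma13 fx) (flux_sigma35 fx) => y z ys zs.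
by rewrite !(dotDl, dotZl) xi ys zs.
Qed.

Lemma A_gt0 i : 0 < A i.
Proof. exact: area_gt0. Qed.

Lemma flux_scale_gt0 : 0 < flux_scale A (height E).
Proof. by rewrite /flux_scale !addr_gt0 // mulr_gt0 ?area_gt0 ?height_odd. Qed.

Lemma vec_flux_inj c a p q : (forall i, vec_flux c a p q i = 0) ->
  [/\ c = 0, a = 0, p = 0 & q = 0].
Proof.
move=> F0; 
have ca : c = - a *: x024 E.
  apply/eqP; rewrite scaleNr -addr_eq0; apply/eqP/even_normals_free => k.
  have := F0 (facet k false); have := @height_even (facet k false).
  rewrite side_facet heightE => /(_ isT)/eqP; rewrite subr_eq0 => /eqP h.
  rewrite dotDl dotZl -h /vec_flux.
  have -> : s13 (facet k false) = 0.
    by rewrite /s13; elim/ord3_cases: k h => _; rewrite facet_even supp_fluxE.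
  have -> : s35 (facet k false) = 0.
    by rewrite /s35; elim/ord3_cases: k h => _; rewrite facet_even supp_fluxE.
  by rewrite !mulr0 !addr0.
have G i : a * height E i + (p * s13 i + q * s35 i) = 0.
  by rewrite -(F0 i) /vec_flux ca dotZl heightE; ring.
have [a0 p0 q0] := odd_fluxes_inj A_gt0 flux_scale_gt0 (fun i _ => G i).
by split; rewrite // ca a0 oppr0 scale0r.
Qed.

Lemma flux_odd a p q j :
  flux_on j (a *: (@shifted_pos R E + p *: sigma 1 3 + q *: sigma 3 5))
    (a * (height E j + p * s13 j + q * s35 j)).
Proof.
move=> x fx; have -> : (a *: (@shifted_pos R E + p *: sigma 1 3 + q *: sigma 3 5)) x =
  a *: (shifted_pos x + p *: sigma 1 3 x + q *: sigma 3 5 x) by [].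
move: (sigma 1 3 x) (sigma 3 5 x) (flux_sigma13 fx) (flux_sigma35 fx) => y z ys zs.
move: (shifted_pos x) (flux_shifted fx) => s; rewrite -heightE => sh.
by rewrite !(dotDl, dotZl) sh ys zs.
Qed.

Lemma V0_odd a p q :
  V0 (a *: (@shifted_pos R E + p *: sigma 1 3 + q *: sigma 3 5)).
Proof.
apply/V0P; exists (- (a *: x024 E)), a, (a * p), (a * q).
apply/funext => x.
have -> : (a *: (@shifted_pos R E + p *: sigma 1 3 + q *: sigma 3 5)) x =
  a *: (set_val x - x024 E + p *: sigma 1 3 x + q *: sigma 3 5 x) by [].
have -> : vec (- (a *: x024 E)) a (a * p) (a * q) x = - (a *: x024 E) + a *: set_val x
  + ((a * p) *: sigma 1 3 x + (a * q) *: sigma 3 5 x) by [].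
by rewrite !scalerDr !scalerA scalerN addrA [X in X + _ + _]addrC.
Qed.

Lemma flux_phi_odd j : [/\ flux_on j (@phi1 R E) (1 == j)%:R,
  flux_on j (@phi3 R E) (3 == j)%:R & flux_on j (@phi5 R E) (5 == j)%:R].
Proof.
have [e1 e3 e5] := odd_fluxes_dual A_gt0 flux_scale_gt0 j height_even.
rewrite /= in e1 e3 e5; rewrite /phi1 /phi3 /phi5 -!(scaleNr _ (sigma _ _)).
by split; [rewrite -e1 | rewrite -e3 | rewrite -e5]; exact: flux_odd.
Qed.

Lemma V0_phi_odd : [/\ V0 (@phi1 R E), V0 (@phi3 R E) & V0 (@phi5 R E)].
Proof. by rewrite /phi1 /phi3 /phi5 -!(scaleNr _ (sigma _ _)); split; exact: V0_odd. Qed.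

Lemma phi_evenE i n : phi_even i n = (dot n (normal E i))^-1 *:
  ((fun=> n) - dot n (normal E 1) *: @phi1 R E - dot n (normal E 3) *: @phi3 R E
   - dot n (normal E 5) *: @phi5 R E).
Proof. by apply/funext. Qed.

Lemma V0_const (n : 'rV[R]_3) : V0 (fun _ : body E => n).
Proof.
apply/V0P; exists n, 0, 0, 0; apply/funext => x.
have -> : vec n 0 0 0 x = n + 0 *: set_val x
  + (0 *: sigma 1 3 x + 0 *: sigma 3 5 x) by [].
by rewrite !scale0r !addr0.
Qed.

Lemma V00 : V0 (0 : body E -> 'rV[R]_3).
Proof. exact: (V0_const 0). Qed.

Lemma V0_scale a v : V0 v -> V0 (a *: v).
Proof. by move=> vV; rewrite -[_ *: _]addr0; apply: V0_lin => //; exact: V00. Qed.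

Lemma V0_sub a u v : V0 u -> V0 v -> V0 (u - a *: v).
Proof. by move=> uV vV; rewrite addrC -scaleNr; exact: V0_lin. Qed.

Lemma V0_phi_even i n : V0 (@phi_even R E i n).
Proof.
have [V1 V3 V5] := V0_phi_odd; rewrite phi_evenE; apply: V0_scale.
by do 3![apply: V0_sub => //]; exact: V0_const.
Qed.

Lemma flux_phi_even i j n : ~~ side i -> dot n (normal E i) != 0 ->
  (forall l, ~~ side l -> l != i -> dot n (normal E l) = 0) ->
  flux_on j (@phi_even R E i n) (i == j)%:R.
Proof.
move=> si ni nl x fx; have [f1 f3 f5] := flux_phi_odd j.
rewrite /phi_even; move: (phi1 x) (phi3 x) (phi5 x) (f1 x fx) (f3 x fx) (f5 x fx).
move=> p1 p3 p5 e1 e3 e5; rewrite dotZl !dotBl !dotZl e1 e3 e5.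
have [ij|ij] := eqVneq i j.
  have out m : side m -> (m == j) = false.
    by move=> sm; apply: contraNF si => /eqP mj; rewrite ij -mj.
  by rewrite !out // !mulr0 !subr0 -ij mulVf.
have [sj|sj] := boolP (side j); last first.
  have out m : side m -> (m == j) = false.
    by move=> sm; apply: contraNF sj => /eqP <-.
  by rewrite !out // !mulr0 !subr0 (nl j) 1?eq_sym // mulr0.
by rewrite (odd_facet_sum (fun m => dot n (normal E m))) // mulr0.
Qed.

(** The vector n_i is orthogonal to the normals of the two even faces other
    than i, and n_i . nu_i is, up to sign, the determinant of the three even normals. *)
Lemma phi_cases (P : 'I_6 -> (body E -> 'rV[R]_3) -> Prop) :
  P 1 (@phi1 R E) -> P 3 (@phi3 R E) -> P 5 (@phi5 R E) ->
  (forall i n, ~~ side i -> dot n (normal E i) != 0 ->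
    (forall l, ~~ side l -> l != i -> dot n (normal E l) = 0) ->
    P i (phi_even i n)) ->
  forall i, P i (@phi R E i).
Proof.
move=> P1 P3 P5 Peven.
have dot_cross_l (y z : 'rV[R]_3) : dot (cross y z) y = 0.
  by rewrite !coordE; ring.
have dot_cross_r (y z : 'rV[R]_3) : dot (cross y z) z = 0.
  by rewrite !coordE; ring.
have N0 := even_normals_det 0; have N1 := even_normals_det 1.
have N2 := even_normals_det 2; move: N0 N1 N2.
rewrite !add0r !ord3_addE !facet_even => N0 N1 N2.
elim/ord6_cases; rewrite /phi //=; apply: Peven => //.
- by elim/ord6_cases => // _ _; rewrite ?dot_cross_l ?dot_cross_r.
- by rewrite cross_anti -scaleN1r dotZl mulf_neq0 // oppr_eq0 oner_eq0.
- by elim/ord6_cases => // _ _; rewrite ?dot_cross_l ?dot_cross_r.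
- by elim/ord6_cases => // _ _; rewrite ?dot_cross_l ?dot_cross_r.
Qed.

Lemma flux_phi i j : flux_on j (@phi R E i) (i == j)%:R.
Proof.
have [f1 f3 f5] := flux_phi_odd j.
apply: (phi_cases (P := fun i v => flux_on j v (i == j)%:R)) => // k n.
exact: flux_phi_even.
Qed.

Lemma V0_phi i : V0 (@phi R E i).
Proof.
have [V1 V3 V5] := V0_phi_odd.
by apply: (phi_cases (P := fun _ v => V0 v)) => // k n *; exact: V0_phi_even.
Qed.

Lemma V0_flux v i : V0 v -> exists c, flux_on i v c.
Proof. by move=> /V0P[c [a [p [q ->]]]]; eexists; exact: flux_vec. Qed.

Lemma fluxes_on v i : V0 v -> flux_on i v (fluxes v 0 i).
Proof. by move=> /(V0_flux i)[c vc]; rewrite (fluxesE vc). Qed.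

Lemma fluxes_lin a u v : V0 u -> V0 v ->
  fluxes (a *: u + v) = a *: fluxes u + fluxes v.
Proof.
move=> uV vV; apply/rowP => i; rewrite [RHS]mxE [X in _ = X + _]mxE.
by apply: fluxesE; apply: flux_lin; exact: fluxes_on.
Qed.

Lemma fluxes_eq0 (c : 'rV[R]_3) a p q : fluxes (vec c a p q) = 0 ->
  [/\ c = 0, a = 0, p = 0 & q = 0].
Proof.
move=> F0; apply: vec_flux_inj => i.
by rewrite -(fluxesE (@flux_vec c a p q i)) F0 mxE.
Qed.

Lemma vec0 : vec 0 0 0 0 = 0.
Proof.
apply/funext => x; have -> : vec 0 0 0 0 x = 0 + 0 *: set_val x
  + (0 *: sigma 1 3 x + 0 *: sigma 3 5 x) by [].
by rewrite !scale0r !addr0.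
Qed.

(** Injectivity is [vec_flux_inj] for the difference, and the functions [phi i]
    are dual to the fluxes. *)
Lemma fluxes_bij : set_bij (@V0 R E) [set: 'rV[R]_6] (@fluxes R E).
Proof.
split=> // [u v /set_mem uV /set_mem vV uv|r _].
  have : fluxes (- 1 *: v + u) = 0.
    by rewrite fluxes_lin // uv scaleN1r addNr.
  have /V0P[c [a [p [q wE]]]] := V0_lin (- 1) vV uV.
  rewrite wE => /fluxes_eq0[c0 a0 p0 q0].
  move: wE; rewrite c0 a0 p0 q0 vec0 scaleN1r addrC => /eqP.
  by rewrite subr_eq0 => /eqP.
exists (\sum_i r 0 i *: @phi R E i).
  by elim/big_rec: _ => [|i v _ vV]; [exact: V00 | apply: V0_lin => //; exact: V0_phi].
apply/rowP => j; apply: fluxesE.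
have -> : r 0 j = \sum_i r 0 i * (i == j)%:R.
  rewrite (bigD1 j) //= eqxx mulr1 big1 ?addr0 // => i /negPf ->.
  by rewrite mulr0.
by apply: flux_sum => i; exact: flux_phi.
Qed.

Lemma vec_direct v1 v2 v3 : constants v1 -> radials v2 -> supplements v3 ->
  v1 + v2 + v3 = 0 -> [/\ v1 = 0, v2 = 0 & v3 = 0].
Proof.
move=> [c _ <-] [a _ <-] [[p q] _ <-] /=; rewrite -/(vec c a p q) => v0.
have [|-> -> -> ->] := @fluxes_eq0 c a p q.
  rewrite v0; apply/rowP => i; rewrite [RHS]mxE; apply: fluxesE => x _.
  by have -> : (0 : body E -> 'rV[R]_3) x = 0 by []; rewrite dot0l.
split=> //; last by rewrite !scale0r addr0.
by apply/funext => x; rewrite scale0r.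
Qed.

End Fluxes.

Theorem mainTheorem2 (R : realType) (E : hexahedron R)
    (jac_gt0 : forall xh : 'rV[R]_3, ref_cube xh -> 0 < jac E xh) :
  (forall v1 v2 v3 : body E -> 'rV[R]_3,
     constants v1 -> radials v2 -> supplements v3 ->
     v1 + v2 + v3 = 0 -> [/\ v1 = 0, v2 = 0 & v3 = 0]) /\
  (forall v : body E -> 'rV[R]_3, V0 v -> forall i : 'I_6,
     exists c : R, flux_on i v c) /\
  (forall (a : R) (u v : body E -> 'rV[R]_3), V0 u -> V0 v ->
     V0 (a *: u + v) /\ fluxes (a *: u + v) = a *: fluxes u + fluxes v) /\
  set_bij (@V0 R E) [set: 'rV[R]_6] (@fluxes R E) /\
  (forall i : 'I_6, i \in [:: 1; 3; 5] ->
     flux_on i (@shifted_pos R E) (height E i) /\ 0 < height E i) /\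
  (forall i j : 'I_6, flux_on j (@phi R E i) (i == j)%:R).
Proof.
split; first exact: vec_direct.
split; first by move=> v vV i; exact: V0_flux.
split; first by move=> a u v uV vV; split; [exact: V0_lin | exact: fluxes_lin].
split; first exact: fluxes_bij.
split; last exact: flux_phi.
move=> i odd_i; rewrite heightE; split; first exact: flux_shifted.
rewrite -heightE; apply: height_odd; move: odd_i.
by rewrite !inE => /or3P[] /eqP ->.
Qed.
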